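(* Let $d\ge 1$, $p>2$ and $A>0$. Let $H=H(x,t,q,X)$ be a real-valued function on $B_1\times[0,1]\times\mathbb R^d\times\mathcal S^d$ such that for all $(x,t)\in B_1\times[0,1]$, $q\in\mathbb R^d$, $X\in\mathcal S^d$, $$\frac1A|q|^p-A\,m^+(X)-A\le H(x,t,q,X)\le A|q|^p-A\,m^-(X)+A .$$ Let $u$ be a bounded continuous viscosity solution of $u_t+H(x,t,Du,D^2u)=0$ in $B_1\times[0,1]$. Then $u$ is $C^\alpha$ (Hölder continuous in $(x,t)$) in $B_{1/2}\times[1/2,1]$, where $\alpha\in(0,1)$ and the $C^\alpha$ norm of $u$ on $B_{1/2}\times[1/2,1]$ are controlled by quantities depending only on $p$, $A$ and $\|u\|_{L^\infty}$ (and the dimension $d$).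
   Context: $B_r\subset\mathbb R^d$ is the ball of radius $r$ centered at $0$; $\mathcal S^d$ is the space of real symmetric $d\times d$ matrices; $Du$, $D^2u$ are the spatial gradient and Hessian. For $X\in\mathcal S^d$, $m^+(X)$ is the maximum positive eigenvalue of $X$ ($0$ if none) and $m^-(X)$ is the minimum negative eigenvalue of $X$ ($0$ if none); so $m^-\le0\le m^+$. Viscosity solution convention ($H$ need not be continuous): a continuous function $u$ is a viscosity subsolution (resp. supersolution) of $u_t+H(x,t,Du,D^2u)=0$ if for every smooth $\varphi$ and every interior point $(x_0,t_0)$ of the domain at which $u-\varphi$ has a local maximum (resp. minimum), $\varphi_t+H(x_0,t_0,D\varphi,D^2\varphi)\le 0$ (resp. $\ge 0$) at $(x_0,t_0)$; a viscosity solution is both. *)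

(* Defs.v *)
From mathcomp Require Import all_boot all_order all_algebra.
From mathcomp Require Import all_classical all_reals all_analysis.

Set Implicit Arguments.
Unset Strict Implicit.
Unset Printing Implicit Defensive.

Import Order.TTheory GRing.Theory Num.Theory.
Import numFieldNormedType.Exports.

Local Open Scope classical_set_scope.
Local Open Scope ring_scope.

(* The library norm on 'rV[R]_d is the sup norm, hence an explicit Euclidean
   norm; the two induce the same topology. *)
Definition enorm (R : realType) (d : nat) (x : 'rV[R]_d) : R :=
  Num.sqrt (\sum_(i < d) x 0 i ^+ 2).

Definition eball (R : realType) (d : nat) (r : R) : set 'rV[R]_d :=
  [set x | enorm x < r].
Arguments eball {R} d r.

Definition cylinder (R : realType) (d : nat) (r a b : R) :
    set ('rV[R]_d * R) :=
  eball d r `*` `[a, b].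
Arguments cylinder {R} d r a b.

Definition edist (R : realType) (d : nat) (z w : 'rV[R]_d * R) : R :=
  Num.sqrt (enorm (z.1 - w.1) ^+ 2 + (z.2 - w.2) ^+ 2).

(* Since sup set0 = inf set0 = 0 in the library, both are 0 when there is no
   eigenvalue of the required sign; otherwise the set is finite and the sup
   (inf) is attained. *)
Definition mplus (R : realType) (d : nat) (X : 'M[R]_d) : R :=
  sup [set a : R | eigenvalue X a /\ 0 < a].

Definition mminus (R : realType) (d : nat) (X : 'M[R]_d) : R :=
  inf [set a : R | eigenvalue X a /\ a < 0].

(* C^infty on an open set U: every iterated directional derivative is
   differentiable at every point of U. *)
Definition smooth_on (R : realType) (d : nat) (U : set ('rV[R]_d * R))
    (f : 'rV[R]_d * R -> R) : Prop :=
  forall (vs : seq ('rV[R]_d * R)) (z : 'rV[R]_d * R), U z ->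
    differentiable (foldr (fun v g => 'D_v g) f vs) z.

Definition sdir (R : realType) (d : nat) (i : 'I_d) : 'rV[R]_d * R :=
  (delta_mx 0 i, 0).

Definition time_derivative (R : realType) (d : nat)
    (f : 'rV[R]_d * R -> R) (z : 'rV[R]_d * R) : R :=
  'D_((0 : 'rV[R]_d), (1 : R)) f z.

Definition gradient (R : realType) (d : nat)
    (f : 'rV[R]_d * R -> R) (z : 'rV[R]_d * R) : 'rV[R]_d :=
  \row_(i < d) 'D_(sdir R i) f z.

Definition hessian (R : realType) (d : nat)
    (f : 'rV[R]_d * R -> R) (z : 'rV[R]_d * R) : 'M[R]_d :=
  \matrix_(i < d, j < d) 'D_(sdir R i) ('D_(sdir R j) f) z.

Definition hamiltonian (R : realType) (d : nat) : Type :=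
  'rV[R]_d -> R -> 'rV[R]_d -> 'M[R]_d -> R.

Definition pde_lhs (R : realType) (d : nat) (H : hamiltonian R d)
    (f : 'rV[R]_d * R -> R) (z : 'rV[R]_d * R) : R :=
  time_derivative f z + H z.1 z.2 (gradient f z) (hessian f z).

Definition viscosity_subsolution (R : realType) (d : nat)
    (Q : set ('rV[R]_d * R)) (H : hamiltonian R d)
    (u : 'rV[R]_d * R -> R) : Prop :=
  {within Q, continuous u} /\
  forall (phi : 'rV[R]_d * R -> R) (z0 : 'rV[R]_d * R),
    smooth_on (interior Q) phi -> interior Q z0 ->
    (\forall z \near z0, u z - phi z <= u z0 - phi z0) ->
    pde_lhs H phi z0 <= 0.

Definition viscosity_supersolution (R : realType) (d : nat)
    (Q : set ('rV[R]_d * R)) (H : hamiltonian R d)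
    (u : 'rV[R]_d * R -> R) : Prop :=
  {within Q, continuous u} /\
  forall (phi : 'rV[R]_d * R -> R) (z0 : 'rV[R]_d * R),
    smooth_on (interior Q) phi -> interior Q z0 ->
    (\forall z \near z0, u z0 - phi z0 <= u z - phi z) ->
    0 <= pde_lhs H phi z0.

Definition viscosity_solution (R : realType) (d : nat)
    (Q : set ('rV[R]_d * R)) (H : hamiltonian R d)
    (u : 'rV[R]_d * R -> R) : Prop :=
  viscosity_subsolution Q H u /\ viscosity_supersolution Q H u.

Definition sup_norm (R : realType) (d : nat) (D : set ('rV[R]_d * R))
    (u : 'rV[R]_d * R -> R) : \bar R :=
  ereal_sup [set (`|u z|)%:E | z in D].

Definition holder_seminorm (R : realType) (d : nat) (alpha : R)
    (D : set ('rV[R]_d * R)) (u : 'rV[R]_d * R -> R) : \bar R :=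
  ereal_sup [set e : \bar R | exists z w : 'rV[R]_d * R,
    [/\ D z, D w, z <> w & e = (`|u z - u w| / edist z w `^ alpha)%:E]].

Definition holder_norm (R : realType) (d : nat) (alpha : R)
    (D : set ('rV[R]_d * R)) (u : 'rV[R]_d * R -> R) : \bar R :=
  (sup_norm D u + holder_seminorm alpha D u)%E.

Definition growth_condition (R : realType) (d : nat) (p A : R)
    (Q : set ('rV[R]_d * R)) (H : hamiltonian R d) : Prop :=
  forall (x : 'rV[R]_d) (t : R) (q : 'rV[R]_d) (X : 'M[R]_d),
    Q (x, t) -> X^T = X ->
    A^-1 * enorm q `^ p - A * mplus X - A <= H x t q X /\
    H x t q X <= A * enorm q `^ p - A * mminus X + A.

(* Main.v *)
Require Import Defs.
From HB Require Import structures.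
From mathcomp Require Import all_boot all_order all_algebra.
From mathcomp Require Import all_classical all_reals all_analysis.
From mathcomp Require Import ring lra.

Set Implicit Arguments.
Unset Strict Implicit.
Unset Printing Implicit Defensive.

Import Order.TTheory GRing.Theory Num.Theory.
Import numFieldNormedType.Exports.

Local Open Scope classical_set_scope.
Local Open Scope ring_scope.

(* Testing [u] and [- u] by paraboloids whose coefficients depend on time, the
   growth condition says that [u_t + |Du|^p / A <= A m^+(D^2 u) + A], and the same
   for [- u] with [- A |Du|^p] instead.  In a cylinder of radius [r] and height
   [T] with [(omega / r)^p = omega / T], where [omega] bounds the oscillation,
   the rescaled equation keeps its gradient term while the second- and
   zeroth-order terms carry the factors [T / r^2] and [T / omega]; since [p > 2]
   both stay small along the iteration.  A barrier of the form
   [tau^(1-b) + K |xi|^2 tau^(-b)] propagates a low value of [u] at one point of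
   the bottom to the whole upper part; if there is no low value, a linear-in-time
   barrier raises the infimum.  Either way the oscillation drops by a fixed
   factor, and iterating gives the Hoelder modulus. *)

(** A barrier is never itself a test function, since its powers of time would have to be shown
    smooth. At a contact point it is replaced by a polynomial paraboloid lying above it, with the
    same value and time slope. Every test then has Hessian [2 b0 I], whose extremal eigenvalues are
    explicit. The growth condition is not symmetric. For [u] the gradient term has the good sign and
    can beat the singular time derivative of the barrier. For [- u] it has the bad sign, and only a
    barrier of small amplitude [theta] survives, because its gradient costs order [theta ^ p]
    against a time slope of order [theta]. The barrier centred at a low point is infinite at time
    zero away from that point. Mere continuity of [u] there is enough to start the comparison, and
    no modulus of continuity enters the constants. The equation is tested only at interior points,
    so estimates hold on time intervals open at the top; the top slice is recovered by continuity at
    the end. *)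

Section spacetime_polynomials.
Context {R : realType} {d : nat}.
Local Notation E := ('rV[R]_d * R)%type.
Implicit Types (f g : E -> R) (z v : E).

(** [smooth_on] asks for differentiability of every iterated directional derivative. A class closed
    under directional derivatives, all of whose members are differentiable, settles this by
    induction on the list of directions. *)
Inductive spacetime_poly : (E -> R) -> Prop :=
| spacetime_poly_cst c : spacetime_poly (fun=> c)
| spacetime_poly_coord i : spacetime_poly (fun z => z.1 0 i)
| spacetime_poly_time : spacetime_poly (fun z => z.2)
| spacetime_polyD f g : spacetime_poly f -> spacetime_poly g ->
    spacetime_poly (fun z => f z + g z)
| spacetime_polyM f g : spacetime_poly f -> spacetime_poly g ->
    spacetime_poly (fun z => f z * g z).

Lemma spacetime_poly_sum (I : Type) (s : seq I) (F : I -> E -> R) :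
  (forall i, spacetime_poly (F i)) ->
  spacetime_poly (fun z => \sum_(i <- s) F i z).
Proof.
move=> F_poly; elim: s => [|i s IHs].
  rewrite (_ : (fun z => _) = fun=> 0); first exact: spacetime_poly_cst.
  by apply/funext => z; rewrite big_nil.
rewrite (_ : (fun z => _) = fun z => F i z + \sum_(j <- s) F j z).
  exact: spacetime_polyD.
by apply/funext => z; rewrite big_cons.
Qed.

Lemma linear_derive (f : {linear E -> R}) z v :
  continuous f -> differentiable f z /\ 'D_v f z = f v.
Proof.
move=> cf; have df := @linear_differentiable _ _ _ f z cf.
by split=> //; rewrite deriveE// diff_lin.
Qed.

Lemma coord_linear (i : 'I_d) : linear (fun z : E => z.1 0 i).
Proof. by move=> a x y; rewrite /= !mxE. Qed.

Lemma time_linear : linear (fun z : E => z.2).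
Proof. by []. Qed.

Lemma coord_continuous_pair (i : 'I_d) : continuous (fun z : E => z.1 0 i).
Proof.
move=> z; apply: (@continuous_comp _ _ _ fst (fun x : 'rV[R]_d => x 0 i)).
  exact: cvg_fst.
exact: coord_continuous.
Qed.

Lemma derive_coord (i : 'I_d) z v :
  differentiable (fun z : E => z.1 0 i) z /\ 'D_v (fun z : E => z.1 0 i) z = v.1 0 i.
Proof.
pose f := GRing.isLinear.Build R E R _ _ (coord_linear i).
pose F : {linear E -> R} := HB.pack (fun z : E => z.1 0 i) f.
exact: (@linear_derive F z v (@coord_continuous_pair i)).
Qed.

Lemma derive_time z v :
  differentiable (fun z : E => z.2) z /\ 'D_v (fun z : E => z.2) z = v.2.
Proof.
pose f := GRing.isLinear.Build R E R _ _ time_linear.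
pose F : {linear E -> R} := HB.pack (fun z : E => z.2) f.
by apply: (@linear_derive F z v) => y; exact: cvg_snd.
Qed.

Lemma spacetime_poly_derive f : spacetime_poly f ->
  (forall z, differentiable f z) /\ (forall v, spacetime_poly ('D_v f)).
Proof.
elim=> {f} [c|i||f g fp [fd fD] gp [gd gD]|f g fp [fd fD] gp [gd gD]].
- split=> [z|v]; first exact: differentiable_cst.
  rewrite (_ : 'D_v _ = fun=> 0); first exact: spacetime_poly_cst.
  by apply/funext => z; exact: derive_cst.
- split=> [z|v]; first by case: (derive_coord i z z).
  rewrite (_ : 'D_v _ = fun=> v.1 0 i); first exact: spacetime_poly_cst.
  by apply/funext => z; case: (derive_coord i z v).
- split=> [z|v]; first by case: (derive_time z z).
  rewrite (_ : 'D_v _ = fun=> v.2); first exact: spacetime_poly_cst.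
  by apply/funext => z; case: (derive_time z v).
- split=> [z|v]; first exact: (differentiableD (fd z) (gd z)).
  rewrite (_ : 'D_v _ = fun z => 'D_v f z + 'D_v g z); first exact: spacetime_polyD.
  by apply/funext => z; apply: deriveD; exact: diff_derivable.
- split=> [z|v]; first exact: (differentiableM (fd z) (gd z)).
  rewrite (_ : 'D_v _ = fun z => f z * 'D_v g z + g z * 'D_v f z).
    by apply: spacetime_polyD; exact: spacetime_polyM.
  by apply/funext => z; apply: deriveM; exact: diff_derivable.
Qed.

Lemma spacetime_poly_smooth f (U : set E) : spacetime_poly f -> smooth_on U f.
Proof.
move=> fp vs z _; suff /spacetime_poly_derive[fd _] :
  spacetime_poly (foldr (fun v g => 'D_v g) f vs) by [].
by elim: vs => //= v vs /spacetime_poly_derive[_]; exact.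
Qed.

Lemma derive_polyD f g z v : spacetime_poly f -> spacetime_poly g ->
  'D_v (fun z => f z + g z) z = 'D_v f z + 'D_v g z.
Proof.
move=> /spacetime_poly_derive[fd _] /spacetime_poly_derive[gd _].
by apply: deriveD; exact: diff_derivable.
Qed.

Lemma derive_polyM f g z v : spacetime_poly f -> spacetime_poly g ->
  'D_v (fun z => f z * g z) z = f z * 'D_v g z + g z * 'D_v f z.
Proof.
move=> /spacetime_poly_derive[fd _] /spacetime_poly_derive[gd _].
by apply: deriveM; exact: diff_derivable.
Qed.

Lemma derive_poly_cst (c : R) z v : 'D_v (fun=> c) z = 0.
Proof. exact: derive_cst. Qed.

Lemma derive_poly_sum (I : Type) (s : seq I) (F : I -> E -> R) z v :
  (forall i, spacetime_poly (F i)) ->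
  'D_v (fun z => \sum_(i <- s) F i z) z = \sum_(i <- s) 'D_v (F i) z.
Proof.
move=> Fp; elim: s => [|i s IHs].
  rewrite big_nil (_ : (fun z => _) = fun=> 0); first exact: derive_cst.
  by apply/funext => y; rewrite big_nil.
rewrite big_cons -IHs -derive_polyD//; last exact: spacetime_poly_sum.
by congr ('D_v _ z); apply/funext => y; rewrite big_cons.
Qed.

End spacetime_polynomials.

(** * The Euclidean norm and its continuity *)

Section euclidean_norm.
Context {R : realType} {d : nat}.
Implicit Types x y : 'rV[R]_d.

Lemma sqr_enorm x : enorm x ^+ 2 = \sum_(i < d) x 0 i ^+ 2.
Proof. by rewrite sqr_sqrtr// sumr_ge0// => i _; exact: sqr_ge0. Qed.

Lemma enorm_ge0 x : 0 <= enorm x.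
Proof. exact: sqrtr_ge0. Qed.

Lemma enorm0 : enorm (0 : 'rV[R]_d) = 0.
Proof. by rewrite /enorm big1 ?sqrtr0// => i _; rewrite mxE expr0n. Qed.

Lemma enormZ (c : R) x : enorm (c *: x) = `|c| * enorm x.
Proof.
rewrite /enorm -sqrtr_sqr -sqrtrM ?sqr_ge0// mulr_sumr.
by congr Num.sqrt; apply: eq_bigr => i _; rewrite mxE exprMn.
Qed.

Lemma enormN x : enorm (- x) = enorm x.
Proof. by rewrite -scaleN1r enormZ normrN1 mul1r. Qed.

Lemma enormB x y : enorm (x - y) = enorm (y - x).
Proof. by rewrite -enormN opprB. Qed.

Lemma coord_le_enorm x i : `|x 0 i| <= enorm x.
Proof.
rewrite -sqrtr_sqr ler_sqrt; last by apply: sumr_ge0 => j _; exact: sqr_ge0.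
by rewrite (bigD1 i)//= lerDl sumr_ge0// => j _; exact: sqr_ge0.
Qed.

Lemma enorm_eq0 x : enorm x = 0 -> x = 0.
Proof.
move=> x0; apply/rowP => i; rewrite mxE; apply/eqP.
by rewrite -normr_le0 -x0 coord_le_enorm.
Qed.

Lemma enormD x y : enorm (x + y) <= enorm x + enorm y.
Proof.
have [/eqP/enorm_eq0 ->|x0] := boolP (enorm x == 0).
  by rewrite enorm0 !add0r.
have [/eqP/enorm_eq0 ->|y0] := boolP (enorm y == 0).
  by rewrite enorm0 !addr0.
have {}x0 : 0 < enorm x by rewrite lt_neqAle eq_sym x0 enorm_ge0.
have {}y0 : 0 < enorm y by rewrite lt_neqAle eq_sym y0 enorm_ge0.
rewrite -ler_sqr ?nnegrE ?enorm_ge0 ?addr_ge0 ?enorm_ge0//.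
set l := enorm y / enorm x.
have l0 : 0 < l by exact: divr_gt0.
(* Young's inequality with weight [l], for which its sum over [i] is sharp *)
have young i : (x + y) 0 i ^+ 2 <=
    (1 + l) * x 0 i ^+ 2 + (1 + l^-1) * y 0 i ^+ 2.
  rewrite mxE; have : 0 <= (l * x 0 i - y 0 i) ^+ 2 / l.
    by rewrite divr_ge0 ?sqr_ge0// ltW.
  have -> : (l * x 0 i - y 0 i) ^+ 2 / l =
    l * x 0 i ^+ 2 - 2 * (x 0 i * y 0 i) + l^-1 * y 0 i ^+ 2.
    by field; rewrite gt_eqF.
  by move=> ?; lra.
rewrite sqr_enorm; apply: (le_trans (ler_sum _ (fun i _ => young i))).
rewrite big_split/= -!mulr_sumr -!sqr_enorm /l le_eqVlt; apply/orP; left.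
by apply/eqP; field; rewrite !gt_eqF.
Qed.

Lemma continuous_enorm : continuous (@enorm R d).
Proof.
have sum_continuous : continuous (fun x : 'rV[R]_d => \sum_(i < d) x 0 i ^+ 2).
  apply: continuous_big => [|i _ x]; first exact: (@add_continuous R).
  apply: (@continuous_comp _ _ _ (fun x : 'rV[R]_d => x 0 i) (fun a => a ^+ 2)).
    exact: coord_continuous.
  exact: exprn_continuous.
by move=> x; apply: (continuous_comp (@sum_continuous x)); exact: sqrt_continuous.
Qed.

Lemma continuous_enorm_center y : continuous (fun x : 'rV[R]_d => enorm (x - y)).
Proof.
move=> x; apply: (@continuous_comp _ _ _ (fun x : 'rV[R]_d => x - y) (@enorm R d)).
  by apply: (@continuousB R 'rV[R]_d _ id (fun=> y)) => //; exact: cst_continuous.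
exact: continuous_enorm.
Qed.

End euclidean_norm.

(** * Derivatives of the paraboloid test functions *)

Section quadratic_tests.
Context {R : realType} {d : nat}.
Local Notation E := ('rV[R]_d * R)%type.
Variables (y : 'rV[R]_d) (t0 : R).

Definition time_quadratic (c0 c1 c2 : R) (z : E) : R :=
  c0 + c1 * (z.2 - t0) + c2 * (z.2 - t0) ^+ 2.

Definition sqdist (z : E) : R := enorm (z.1 - y) ^+ 2.

(** The coefficients [a2] and [b2] do not enter the derivatives at time [t0] that the equation sees;
    they absorb second-order errors in time. The centre [y] is free, so the gradient at the contact
    point can be nonzero. *)
Definition quadratic_test (a1 a2 b0 b1 b2 : R) (z : E) : R :=
  time_quadratic 0 a1 a2 z + time_quadratic b0 b1 b2 z * sqdist z.

Lemma spacetime_poly_shift (f : E -> R) (c : R) : spacetime_poly f -> spacetime_poly (fun z => f z - c).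
Proof.
by move=> fp; apply: (spacetime_polyD fp (spacetime_poly_cst (- c))).
Qed.

Lemma derive_shift (f : E -> R) (c : R) z v :
  spacetime_poly f -> 'D_v (fun z => f z - c) z = 'D_v f z.
Proof.
move=> fp; rewrite (derive_polyD _ _ fp (spacetime_poly_cst (- c))).
by rewrite derive_poly_cst addr0.
Qed.

Lemma time_quadratic_poly c0 c1 c2 : spacetime_poly (time_quadratic c0 c1 c2).
Proof.
have e_poly := spacetime_poly_shift t0 (@spacetime_poly_time R d).
apply: (spacetime_polyD (spacetime_polyD (spacetime_poly_cst c0)
  (spacetime_polyM (spacetime_poly_cst c1) e_poly))).
exact: (spacetime_polyM (spacetime_poly_cst c2) (spacetime_polyM e_poly e_poly)).
Qed.

Lemma derive_time_quadratic c0 c1 c2 z v :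
  'D_v (time_quadratic c0 c1 c2) z = (c1 + 2 * c2 * (z.2 - t0)) * v.2.
Proof.
have tp := @spacetime_poly_time R d.
have ep := spacetime_poly_shift t0 tp.
have e2p := spacetime_polyM ep ep.
have c0p := @spacetime_poly_cst R d c0.
have c1p := @spacetime_poly_cst R d c1.
have c2p := @spacetime_poly_cst R d c2.
rewrite (derive_polyD z v (spacetime_polyD c0p (spacetime_polyM c1p ep))
  (spacetime_polyM c2p e2p)).
rewrite (derive_polyD z v c0p (spacetime_polyM c1p ep)).
rewrite (derive_polyM z v c1p ep) (derive_polyM z v c2p e2p).
rewrite (derive_polyM z v ep ep) (derive_shift _ _ _ tp) (derive_time z v).2.
by rewrite !derive_poly_cst; ring.
Qed.

Lemma sqdistE : sqdist = fun z => \sum_(i < d) (z.1 0 i - y 0 i) * (z.1 0 i - y 0 i).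
Proof.
apply/funext => z; rewrite /sqdist sqr_enorm.
by apply: eq_bigr => i _; rewrite !mxE expr2.
Qed.

Lemma sqdist_poly : spacetime_poly sqdist.
Proof.
rewrite sqdistE; apply: spacetime_poly_sum => i.
have xp := spacetime_poly_shift (y 0 i) (spacetime_poly_coord i).
exact: spacetime_polyM.
Qed.

Lemma derive_sqdist z v :
  'D_v sqdist z = \sum_(i < d) 2 * (z.1 0 i - y 0 i) * v.1 0 i.
Proof.
have cp i := @spacetime_poly_coord R d i.
have xp i := spacetime_poly_shift (y 0 i) (cp i).
rewrite sqdistE derive_poly_sum; last by move=> i; exact: spacetime_polyM.
apply: eq_bigr => i _; rewrite (derive_polyM z v (xp i) (xp i)).
by rewrite (derive_shift _ _ _ (cp i)) (derive_coord i z v).2; ring.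
Qed.

Lemma quadratic_test_poly a1 a2 b0 b1 b2 :
  spacetime_poly (quadratic_test a1 a2 b0 b1 b2).
Proof.
exact: spacetime_polyD (time_quadratic_poly _ _ _)
  (spacetime_polyM (time_quadratic_poly _ _ _) sqdist_poly).
Qed.

Lemma derive_quadratic_test a1 a2 b0 b1 b2 z v :
  'D_v (quadratic_test a1 a2 b0 b1 b2) z =
  (a1 + 2 * a2 * (z.2 - t0)) * v.2 +
  ((b1 + 2 * b2 * (z.2 - t0)) * v.2 * sqdist z +
   time_quadratic b0 b1 b2 z * \sum_(i < d) 2 * (z.1 0 i - y 0 i) * v.1 0 i).
Proof.
have tp c0 c1 c2 := time_quadratic_poly c0 c1 c2.
rewrite (derive_polyD z v (tp _ _ _) (spacetime_polyM (tp _ _ _) sqdist_poly)).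
rewrite (derive_polyM z v (tp _ _ _) sqdist_poly) !derive_time_quadratic.
by rewrite derive_sqdist; ring.
Qed.

Lemma time_derivative_quadratic_test a1 a2 b0 b1 b2 x0 :
  time_derivative (quadratic_test a1 a2 b0 b1 b2) (x0, t0) =
  a1 + b1 * enorm (x0 - y) ^+ 2.
Proof.
rewrite /time_derivative derive_quadratic_test/= subrr !mulr0 !addr0 !mulr1.
by rewrite big1 ?mulr0 ?addr0// => i _; rewrite mxE mulr0.
Qed.

Lemma derive_sdir_quadratic_test a1 a2 b0 b1 b2 i z :
  'D_(sdir R i) (quadratic_test a1 a2 b0 b1 b2) z =
  time_quadratic (2 * b0) (2 * b1) (2 * b2) z * (z.1 0 i - y 0 i).
Proof.
rewrite derive_quadratic_test /= !mulr0 mul0r !add0r.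
rewrite (bigD1 i)//= big1 => [|j /negPf ji]; last first.
  by rewrite mxE/= ji mulr0.
by rewrite mxE !eqxx/= /time_quadratic; ring.
Qed.

Lemma gradient_quadratic_test a1 a2 b0 b1 b2 x0 :
  gradient (quadratic_test a1 a2 b0 b1 b2) (x0, t0) = (2 * b0) *: (x0 - y).
Proof.
apply/rowP => i; rewrite !mxE derive_sdir_quadratic_test /time_quadratic/=.
by rewrite subrr expr0n/= !mulr0 !addr0.
Qed.

Lemma hessian_quadratic_test a1 a2 b0 b1 b2 x0 :
  hessian (quadratic_test a1 a2 b0 b1 b2) (x0, t0) = (2 * b0)%:M.
Proof.
apply/matrixP => i j; rewrite !mxE.
transitivity ('D_(sdir R i) (fun z : E =>
  time_quadratic (2 * b0) (2 * b1) (2 * b2) z * (z.1 0 j - y 0 j)) (x0, t0)).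
  by congr ('D_(sdir R i) _ _); apply/funext => z; exact: derive_sdir_quadratic_test.
have cp := @spacetime_poly_coord R d j.
rewrite (derive_polyM _ _ (time_quadratic_poly _ _ _)
  (spacetime_poly_shift (y 0 j) cp)).
rewrite (derive_shift _ _ _ cp) derive_time_quadratic (derive_coord _ _ _).2/=.
rewrite mxE eqxx/= /time_quadratic/= subrr expr0n/= !mulr0 !addr0.
by rewrite eq_sym mulr_natr.
Qed.

End quadratic_tests.

(** * Extremal eigenvalues of scalar matrices *)

Section extremal_eigenvalues.
Context {R : realType}.

Lemma eigenvalue_scalar d (a c : R) :
  (0 < d)%N -> eigenvalue (c%:M : 'M[R]_d) a <-> a = c.
Proof.
case: d => // d _; split=> [/eigenvalueP[v /= vE v0]|->].
  move: vE; rewrite mul_mx_scalar => /eqP; rewrite -subr_eq0 -scalerBl.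
  by rewrite scaler_eq0 (negPf v0) orbF subr_eq0 => /eqP.
apply/eigenvalueP; exists (const_mx 1); first by rewrite mul_mx_scalar.
by apply/eqP => /rowP /(_ ord0); rewrite !mxE; apply/eqP; exact: oner_neq0.
Qed.

Lemma mplus_scalar d (c : R) : (0 < d)%N -> 0 <= c -> mplus (c%:M : 'M[R]_d) = c.
Proof.
move=> d0; rewrite le_eqVlt => /predU1P[<-|c0]; rewrite /mplus.
  rewrite (_ : [set _ | _] = set0) ?sup0// -subset0 => a [].
  by move=> /(eigenvalue_scalar _ _ d0) ->; rewrite ltxx.
rewrite (_ : [set _ | _] = [set c]) ?sup1//; apply/seteqP; split=> a /=.
  by case=> /(eigenvalue_scalar _ _ d0).
by move=> ->; split=> //; exact/(eigenvalue_scalar _ _ d0).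
Qed.

Lemma mminus_scalar d (c : R) : (0 < d)%N -> c <= 0 -> mminus (c%:M : 'M[R]_d) = c.
Proof.
move=> d0; rewrite le_eqVlt => /predU1P[->|c0]; rewrite /mminus.
  rewrite (_ : [set _ | _] = set0) ?inf0// -subset0 => a [].
  by move=> /(eigenvalue_scalar _ _ d0) ->; rewrite ltxx.
rewrite (_ : [set _ | _] = [set c]) ?inf1//; apply/seteqP; split=> a /=.
  by case=> /(eigenvalue_scalar _ _ d0).
by move=> ->; split=> //; exact/(eigenvalue_scalar _ _ d0).
Qed.

End extremal_eigenvalues.

(** * From viscosity inequalities to paraboloid tests *)

Section quadratic_subsolutions.
Context {R : realType} {d : nat}.
Local Notation E := ('rV[R]_d * R)%type.

(* The inequality [w_t + kappa |Dw|^p <= A m^+(D^2 w) + A], tested only at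
   points of the unit cylinder by convex paraboloids
   [a1 e + a2 e^2 + (b0 + b1 e + b2 e^2) |x - y|^2], where [e = t - t0]. *)
Definition quadratic_subsolution (kappa p A : R) (w : E -> R) : Prop :=
  forall (y x0 : 'rV[R]_d) (t0 a1 a2 b0 b1 b2 : R),
    enorm x0 < 1 -> 0 < t0 < 1 -> 0 <= b0 ->
    (\forall z \near (x0, t0),
      w z - quadratic_test y t0 a1 a2 b0 b1 b2 z <=
      w (x0, t0) - quadratic_test y t0 a1 a2 b0 b1 b2 (x0, t0)) ->
    a1 + b1 * enorm (x0 - y) ^+ 2 + kappa * (2 * b0 * enorm (x0 - y)) `^ p
      - 2 * A * b0 - A <= 0.

Lemma near_fst_enorm (x0 y : 'rV[R]_d) (t0 r : R) : enorm (x0 - y) < r ->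
  \forall z \near (x0, t0), enorm (z.1 - y) < r.
Proof.
move=> x0r.
have c : {for (x0, t0), continuous (fun z : E => enorm (z.1 - y))}.
  apply: (@continuous_comp _ _ _ fst (fun x : 'rV[R]_d => enorm (x - y))).
    exact: cvg_fst.
  exact: continuous_enorm_center.
by apply: (c [set a | a < r]); exact: lt_nbhsl.
Qed.

Lemma near_snd_itv (x0 : 'rV[R]_d) (t0 a b : R) : a < t0 < b ->
  \forall z \near (x0, t0), a < z.2 < b.
Proof.
move=> t0ab; have : \forall t \near t0, t \in `]a, b[%R.
  by apply: near_in_itvoo; rewrite in_itv.
by move=> /(@cvg_snd _ _ (nbhs x0) (nbhs t0) _).
Qed.

Lemma interior_cylinder (x0 : 'rV[R]_d) (t0 : R) : enorm x0 < 1 -> 0 < t0 < 1 ->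
  interior (cylinder d 1 0 1) (x0, t0).
Proof.
move=> x01 t01; rewrite /interior/=.
have := @near_fst_enorm x0 0 t0 1; rewrite subr0 => /(_ x01).
apply: filterS2 (near_snd_itv x0 t01) => z /andP[z0 z1].
by rewrite subr0 => zx; split => //=; rewrite in_itv/= !ltW.
Qed.

Lemma cylinder_center (x0 : 'rV[R]_d) (t0 : R) : enorm x0 < 1 -> 0 <= t0 <= 1 ->
  cylinder d 1 0 1 (x0, t0).
Proof. by move=> x01 t01; split => //=; rewrite in_itv. Qed.

Lemma viscosity_subsolution_quadratic p A H u : (0 < d)%N ->
  growth_condition p A (cylinder d 1 0 1) H ->
  viscosity_subsolution (cylinder d 1 0 1) H u ->
  quadratic_subsolution A^-1 p A u.
Proof.
move=> d0 growth [_ subu] y x0 t0 a1 a2 b0 b1 b2 x01 t01 b00 umax.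
have := subu _ (x0, t0) (spacetime_poly_smooth (quadratic_test_poly y t0 a1 a2 b0 b1 b2))
  (interior_cylinder x01 t01) umax.
rewrite /pde_lhs time_derivative_quadratic_test gradient_quadratic_test.
rewrite hessian_quadratic_test/=; set q := _ *: _; set X := _%:M.
have /andP[t00 t0le1] := t01.
have [+ _] := growth x0 t0 q X (cylinder_center x01 (introT andP (conj (ltW t00) (ltW t0le1))))
  (tr_scalar_mx _ _).
rewrite mplus_scalar// ?mulr_ge0// enormZ ger0_norm ?mulr_ge0//.
by move=> ? ?; lra.
Qed.

Lemma quadratic_testN (y : 'rV[R]_d) t0 a1 a2 b0 b1 b2 z :
  quadratic_test y t0 (- a1) (- a2) (- b0) (- b1) (- b2) z =
  - quadratic_test y t0 a1 a2 b0 b1 b2 z.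
Proof. by rewrite /quadratic_test /time_quadratic; ring. Qed.

(** A maximum of [- u - phi] is a minimum of [u - (- phi)]. The negated paraboloid has Hessian
    [- 2 b0 I], so [m^-] equals [- 2 b0], and the upper growth bound leaves the gradient term with
    coefficient [- A]. *)
Lemma viscosity_supersolution_quadratic p A H u : (0 < d)%N ->
  growth_condition p A (cylinder d 1 0 1) H ->
  viscosity_supersolution (cylinder d 1 0 1) H u ->
  quadratic_subsolution (- A) p A (fun z => - u z).
Proof.
move=> d0 growth [_ supu] y x0 t0 a1 a2 b0 b1 b2 x01 t01 b00 umax.
have := supu _ (x0, t0) (spacetime_poly_smooth
  (quadratic_test_poly y t0 (- a1) (- a2) (- b0) (- b1) (- b2)))
  (interior_cylinder x01 t01).
have umin : \forall z \near (x0, t0),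
    u (x0, t0) - quadratic_test y t0 (- a1) (- a2) (- b0) (- b1) (- b2) (x0, t0) <=
    u z - quadratic_test y t0 (- a1) (- a2) (- b0) (- b1) (- b2) z.
  by apply: filterS umax => z; rewrite !quadratic_testN => ?; lra.
move=> /(_ umin).
rewrite /pde_lhs time_derivative_quadratic_test gradient_quadratic_test.
rewrite hessian_quadratic_test/=; set q := _ *: _; set X := _%:M.
have /andP[t00 t0le1] := t01.
have [_ +] := growth x0 t0 q X (cylinder_center x01 (introT andP (conj (ltW t00) (ltW t0le1))))
  (tr_scalar_mx _ _).
have -> : enorm q = 2 * b0 * enorm (x0 - y).
  by rewrite enormZ mulrN normrN ger0_norm ?mulr_ge0.
rewrite mminus_scalar// ?mulrN ?oppr_le0 ?mulr_ge0//.
by move=> ? ?; lra.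
Qed.

End quadratic_subsolutions.

(** * Comparison with barriers that are quadratic in space *)

Section comparison.
Context {R : realType} {d : nat}.
Local Notation E := ('rV[R]_d * R)%type.

(** Only a bound from above is kept: it is what puts a paraboloid over the barrier. For the barriers
    below, [l] is the derivative of [f] at [t]. *)
Definition quadratic_majorant (f : R -> R) (t l : R) : Prop :=
  exists C delta, 0 < delta /\
    forall e, `|e| < delta -> f (t + e) <= f t + l * e + C * e ^+ 2.

Lemma quadratic_majorantD f g t k l :
  quadratic_majorant f t k -> quadratic_majorant g t l ->
  quadratic_majorant (fun t => f t + g t) t (k + l).
Proof.
move=> [C [e [e0 fC]]] [D [e' [e'0 gD]]].
exists (C + D), (Num.min e e'); split; first by rewrite lt_min e0.
move=> h; rewrite lt_min => /andP[/fC ? /gD ?].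
by rewrite !mulrDl; lra.
Qed.

Lemma quadratic_majorantZ f t k c : 0 <= c ->
  quadratic_majorant f t k -> quadratic_majorant (fun t => c * f t) t (c * k).
Proof.
move=> c0 [C [e [e0 fC]]]; exists (c * C), e; split=> // h /fC hC.
by rewrite -!mulrA -!mulrDr ler_wpM2l.
Qed.

Lemma quadratic_majorant_affine a b t : quadratic_majorant (fun t => a + b * t) t b.
Proof. by exists 0, 1; split=> // h _; rewrite mul0r addr0 mulrDr; lra. Qed.

Lemma quadratic_majorant_sqr_max c t :
  quadratic_majorant (fun t => Num.max (t - c) 0 ^+ 2) t (2 * Num.max (t - c) 0).
Proof.
exists 1, 1; split=> // h _; rewrite mul1r.
case: (leP (t - c) 0) => tc; case: (leP (t + h - c) 0) => thc; nra.
Qed.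

Lemma compact_euclidean_ball (y : 'rV[R]_d) r :
  compact [set x : 'rV[R]_d | enorm (x - y) <= r].
Proof.
apply: (@subclosed_compact _ _ [set x : 'rV[R]_d |
    forall i, `[y 0 i - r, y 0 i + r]%classic (x 0 i)]).
- apply: (@preimage_closed _ _ (fun x : 'rV[R]_d => enorm (x - y)) [set a | a <= r]).
    by move=> x _; exact: continuous_enorm_center.
  exact: closed_le.
- apply: (@rV_compact _ _ (fun i => `[y 0 i - r, y 0 i + r]%classic)) => i.
  exact: segment_compact.
move=> x /= xr i; have := le_trans (coord_le_enorm (x - y) i) xr.
by rewrite !mxE ler_norml in_itv/= => ?; lra.
Qed.

(** If [w] exceeds the barrier at time [t1], maximise the excess minus a penalty
    [N * max(t - t1, 0)^2] over a compact cylinder ending strictly before [t2]. The boundary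
    hypotheses exclude the bottom and the side, the penalty excludes the top. At the interior
    maximum the penalty adds a nonnegative time slope, so the strict inequality still contradicts
    the subsolution test. *)
Lemma comparison kappa p A (w : E -> R) (y : 'rV[R]_d) (r s t2 : R)
    (f g f1 g1 : R -> R) :
  quadratic_subsolution kappa p A w ->
  {within cylinder d 1 0 1, continuous w} ->
  0 <= s -> t2 <= 1 ->
  (forall x, enorm (x - y) <= r -> enorm x < 1) ->
  (forall t, s <= t < t2 -> {for t, continuous f}) ->
  (forall t, s <= t < t2 -> {for t, continuous g}) ->
  (forall t, s < t < t2 -> quadratic_majorant f t (f1 t)) ->
  (forall t, s < t < t2 -> quadratic_majorant g t (g1 t)) ->
  (forall t, s < t < t2 -> 0 <= g t) ->
  (forall t rho, s < t < t2 -> 0 <= rho < r ->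
    0 < f1 t + g1 t * rho ^+ 2 + kappa * (2 * g t * rho) `^ p
      - 2 * A * g t - A) ->
  (forall x, enorm (x - y) <= r -> w (x, s) <= f s + g s * enorm (x - y) ^+ 2) ->
  (forall x t, enorm (x - y) = r -> s <= t < t2 -> w (x, t) <= f t + g t * r ^+ 2) ->
  forall x t, enorm (x - y) <= r -> s <= t < t2 ->
    w (x, t) <= f t + g t * enorm (x - y) ^+ 2.
Proof.
move=> subw cw s0 t21 ball cf cg fmaj gmaj g0 strict bottom side x t1 xr st1.
rewrite leNgt; apply/negP => wx.
have /andP[st1' t12] := st1.
set t3 := (t1 + t2) / 2.
have [t13 t32] : t1 < t3 /\ t3 < t2 by rewrite /t3; lra.
set K : set E := [set x : 'rV[R]_d | enorm (x - y) <= r] `*` `[s, t3].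
have Kxt1 : K (x, t1) by split=> //=; rewrite in_itv/= st1' ltW.
have K0 : K !=set0 by exists (x, t1).
have cK : compact K.
  by apply: compact_setX; [exact: compact_euclidean_ball|exact: segment_compact].
have KQ : K `<=` cylinder d 1 0 1.
  move=> z [/= /ball zr]; rewrite in_itv/= => z2; split=> //=; rewrite in_itv/=; lra.
set h0 := fun z : E => w z - (f z.2 + g z.2 * enorm (z.1 - y) ^+ 2).
set pen := fun z : E => Num.max (z.2 - t1) 0 ^+ 2.
have ch0 : {within K, continuous h0}.
  apply: within_continuousB; first exact: continuous_subspaceW cw.
  apply: continuous_in_subspaceT => -[z t] /set_mem[/= _]; rewrite in_itv/= => zt.
  have zt2 : s <= t < t2 by lra.
  have c2 (k : R -> R) : {for t, continuous k} -> {for (z, t), continuous (fun z : E => k z.2)}.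
    by move=> ck; apply: (@continuous_comp _ _ _ snd k); [exact: cvg_snd|exact: ck].
  have c1 : {for (z, t), continuous (fun z : E => enorm (z.1 - y) ^+ 2)}.
    apply: (@continuous_comp _ _ _ fst (fun x : 'rV[R]_d => enorm (x - y) ^+ 2)).
      exact: cvg_fst.
    apply: (@continuous_comp _ _ _ (fun x : 'rV[R]_d => enorm (x - y)) (fun a => a ^+ 2)).
      exact: continuous_enorm_center.
    exact: exprn_continuous.
  exact: (continuousD (c2 _ (cf _ zt2)) (continuousM (c2 _ (cg _ zt2)) c1)).
have cpen : continuous pen.
  move=> z; apply: (@continuous_comp _ _ _ snd (fun t => Num.max (t - t1) 0 ^+ 2)).
    exact: cvg_snd.
  apply: (@continuous_comp _ _ _ (fun t => Num.max (t - t1) 0) (fun a => a ^+ 2)).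
    apply: (@continuous_max _ _ (fun t => t - t1) (fun=> 0)).
      apply: (@continuousB R R _ id (fun=> t1)); last exact: cst_continuous.
      exact: (@cvg_id _ (nbhs z.2)).
    exact: cst_continuous.
  exact: exprn_continuous.
have [c0 _ c0max] := compact_EVT_max K0 cK ch0.
have h0c0 : 0 < h0 c0.
  by apply: (lt_le_trans _ (c0max (x, t1) (mem_set Kxt1))); rewrite /h0 subr_gt0.
(* With this [N] the penalty at time [t3] equals the largest excess, so the penalised function is
   nonpositive on the top slice. *)
set N := h0 c0 / (t3 - t1) ^+ 2.
have t31 : 0 < (t3 - t1) ^+ 2 by rewrite exprn_gt0// subr_gt0.
have N0 : 0 < N by rewrite divr_gt0.
set h := fun z => h0 z - N * pen z.
have ch : {within K, continuous h}.
  apply: within_continuousB => //; apply: continuous_subspaceT => z.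
  by apply: (@continuousM _ _ (fun=> N)); [exact: cst_continuous|exact: cpen].
have [[xc tc] /set_mem[/= xcr]] := compact_EVT_max K0 cK ch.
rewrite in_itv/= => tcK cmax.
have hc : 0 < h (xc, tc).
  apply: (lt_le_trans _ (cmax (x, t1) (mem_set Kxt1))).
  by rewrite /h /pen/= subrr maxxx expr0n/= mulr0 subr0 /h0 subr_gt0.
have pen0 : 0 <= N * pen (xc, tc) by rewrite mulr_ge0 ?sqr_ge0 ?ltW.
have stc : s < tc.
  rewrite lt_neqAle; case/andP: (tcK) => -> _; rewrite andbT; apply/eqP => tcs.
  by have := bottom xc xcr; move: hc pen0; rewrite /h /h0/= -tcs; lra.
have tct3 : tc < t3.
  rewrite lt_neqAle; case/andP: (tcK) => _ ->; rewrite andbT; apply/eqP => tct.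
  have : h0 (xc, tc) <= h0 c0 by apply: c0max; apply/mem_set; split=> //=; rewrite in_itv.
  move: hc; rewrite /h /pen/= tct max_l; last by rewrite subr_ge0 ltW.
  by rewrite divfK ?gt_eqF//; lra.
have rc : enorm (xc - y) < r.
  rewrite lt_neqAle xcr andbT; apply/eqP => rc.
  have tcs : s <= tc < t2 by lra.
  by have := side _ _ rc tcs; move: hc pen0; rewrite /h /h0/= rc; lra.
have tc2 : s < tc < t2 by clear - stc tcK t32; lra.
(* The second-order constants [Cf] and [Cg] become the coefficients [a2] and [b2] of the paraboloid
   that touches [w] at the maximum point. *)
have [Cf [ef [ef0 fC]]] := quadratic_majorantD (fmaj _ tc2)
  (quadratic_majorantZ (ltW N0) (quadratic_majorant_sqr_max t1 tc)).
have [Cg [eg [eg0 gC]]] := gmaj _ tc2.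
set m := Num.max (tc - t1) 0 in fC.
have m0 : 0 <= m by rewrite /m le_max lexx orbT.
have tc01 : 0 < tc < 1 by clear - stc tcK t32 t21 s0; lra.
have := subw y xc tc (f1 tc + N * (2 * m)) Cf (g tc) (g1 tc) Cg
  (ball _ (ltW rc)) tc01 (g0 _ tc2).
suff near_max : \forall z \near (xc, tc), w z -
    quadratic_test y tc (f1 tc + N * (2 * m)) Cf (g tc) (g1 tc) Cg z <=
    w (xc, tc) -
    quadratic_test y tc (f1 tc + N * (2 * m)) Cf (g tc) (g1 tc) Cg (xc, tc).
  move=> /(_ near_max).
  have := strict tc (enorm (xc - y)) tc2; rewrite enorm_ge0 rc => /(_ isT).
  have : 0 <= N * (2 * m) by apply: (mulr_ge0 (ltW N0)); exact: mulr_ge0.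
  by clear - m0; lra.
have nf : tc - ef < tc < tc + ef by clear - ef0; lra.
have ng : tc - eg < tc < tc + eg by clear - eg0; lra.
have nst : s < tc < t3 by clear - tct3 stc; lra.
apply: filterS2 (filterI (near_snd_itv xc nf) (near_snd_itv xc ng))
  (filterI (near_snd_itv xc nst) (near_fst_enorm tc rc)).
move=> [z t]/= [tf tg] [st zr].
have zK : (z, t) \in K by apply/mem_set; split=> /=; [exact: ltW|rewrite in_itv/=; clear - st; lra].
have := cmax _ zK; rewrite /h /h0 /pen/= /quadratic_test /time_quadratic /sqdist/=.
rewrite subrr expr0n/= !mulr0 !addr0 add0r.
have /fC : `|t - tc| < ef by rewrite ltr_norml; clear - tf; lra.
have /gC : `|t - tc| < eg by rewrite ltr_norml; clear - tg; lra.
rewrite addrC subrK -/m => gt ft.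
have := ler_wpM2r (sqr_ge0 (enorm (z - y))) gt.
by move: ft; rewrite -/m; clear - m0; lra.
Qed.

End comparison.

(** * The singular power barrier *)

Section power_barrier.
Context {R : realType}.
Implicit Types (a b s t T tau : R).

(** This is Young's inequality for the product of [(1 + h)^a] and [1], with conjugate exponents
    [1 / a] and [1 / (1 - a)]. *)
Lemma powR_bernoulli a h : 0 < a -> a < 1 -> -1 <= h -> (1 + h) `^ a <= 1 + a * h.
Proof.
move=> a0 a1 h1.
have h0 : 0 <= 1 + h by lra.
have q : 0 < (1 - a)^-1 by rewrite invr_gt0; lra.
have p0 : 0 < a^-1 by rewrite invr_gt0.
have := @conjugate_powR R ((1 + h) `^ a) 1 a^-1 (1 - a)^-1 (powR_ge0 _ _) ler01 p0 q.
rewrite !invrK -powRrM divff ?gt_eqF// powRr1// powR1.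
have -> : a + (1 - a) = 1 by ring.
by move=> /(_ erefl); lra.
Qed.

(** Write [- b] as [(1 - b) - 1], apply the concave bound to [1 - b] and divide by [1 + h]. The
    coefficient [2] suffices because [2 + 2 * h - b] stays positive for [h >= - 1 / 2]. *)
Lemma powR_bernoulli_neg b h : 0 < b -> b < 1 -> `|h| <= 2^-1 ->
  (1 + h) `^ (- b) <= 1 - b * h + 2 * h ^+ 2.
Proof.
move=> b0 b1; rewrite ler_norml => /andP[h1 h2].
have h0 : 0 < 1 + h by lra.
have h0' : 0 <= 1 + h by lra.
have -> : - b = (1 - b) - 1 by ring.
rewrite powRB; last by rewrite (gt_eqF h0) implybT.
rewrite powRr1// ler_pdivrMr//.
have : (1 + h) `^ (1 - b) <= 1 + (1 - b) * h by apply: powR_bernoulli; lra.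
move=> /le_trans; apply.
have -> : (1 - b * h + 2 * h ^+ 2) * (1 + h) =
  1 + (1 - b) * h + h ^+ 2 * (2 + 2 * h - b) by ring.
rewrite lerDl mulr_ge0 ?sqr_ge0//; lra.
Qed.

Lemma powR_subr1 tau a : 0 < tau -> tau `^ (a - 1) = tau `^ a / tau.
Proof.
by move=> t0; rewrite powRB ?powRr1 ?(ltW t0)// (gt_eqF t0) implybT.
Qed.

Lemma powR_le1 a tau : 0 <= a -> 0 <= tau <= 1 -> tau `^ a <= 1.
Proof.
move=> a0 /andP[tau0 tau1]; have := @ge0_ler_powR R a a0 tau 1.
by rewrite powR1 !nnegrE; exact.
Qed.

Lemma powRN_ge1 a tau : 0 <= a -> 0 < tau <= 1 -> 1 <= tau `^ (- a).
Proof.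
move=> a0 /andP[tau0 tau1]; rewrite powRN invf_ge1 ?powR_gt0//.
by apply: powR_le1 => //; rewrite tau1 ltW.
Qed.

(** By concavity the tangent line is already a majorant, so the quadratic constant is [0]. *)
Lemma quadratic_majorant_powR a s T t : 0 < a -> a < 1 -> 0 < T -> s < t ->
  quadratic_majorant (fun t => ((t - s) / T) `^ a) t
    (a * ((t - s) / T) `^ (a - 1) / T).
Proof.
move=> a0 a1 T0 st; exists 0, (t - s); split; first by lra.
move=> e; rewrite ltr_norml => /andP[e1 e2].
have tau0 : 0 < (t - s) / T by apply: divr_gt0 => //; lra.
rewrite powR_subr1// mul0r addr0.
have -> : (t + e - s) / T = ((t - s) / T) * (1 + e / (t - s)).
  by field; rewrite !gt_eqF//; lra.
have h1 : -1 <= e / (t - s) by rewrite ler_pdivlMr; lra.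
rewrite powRM; [|exact: ltW|lra].
have := ler_wpM2l (powR_ge0 ((t - s) / T) a) (powR_bernoulli a0 a1 h1).
move=> /le_trans; apply; rewrite le_eqVlt; apply/orP; left; apply/eqP.
by field; rewrite !gt_eqF//; lra.
Qed.

Lemma quadratic_majorant_powRN b s T t : 0 < b -> b < 1 -> 0 < T -> s < t ->
  quadratic_majorant (fun t => ((t - s) / T) `^ (- b)) t
    (- b * ((t - s) / T) `^ (- b - 1) / T).
Proof.
move=> b0 b1 T0 st; set P := ((t - s) / T) `^ (- b).
exists (2 * P / (t - s) ^+ 2), ((t - s) / 2); split; first by lra.
move=> e; rewrite ltr_norml => /andP[e1 e2].
have tau0 : 0 < (t - s) / T by apply: divr_gt0 => //; lra.
rewrite powR_subr1//.
have -> : (t + e - s) / T = ((t - s) / T) * (1 + e / (t - s)).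
  by field; rewrite !gt_eqF//; lra.
have h1 : `|e / (t - s)| <= 2^-1.
  have ts : 0 < t - s by lra.
  by rewrite ler_norml ler_pdivlMr// ler_pdivrMr//; apply/andP; split; lra.
have h2 := h1; move: h2; rewrite ler_norml => /andP[h2 _].
rewrite powRM; [|exact: ltW|lra].
have := ler_wpM2l (powR_ge0 ((t - s) / T) (- b)) (powR_bernoulli_neg b0 b1 h1).
move=> /le_trans; apply; rewrite le_eqVlt -/P; apply/orP; left; apply/eqP.
by field; rewrite !gt_eqF//; lra.
Qed.

Lemma continuous_powR_rescaled a s T t : 0 < T -> s < t ->
  {for t, continuous (fun t => ((t - s) / T) `^ a)}.
Proof.
move=> T0 st.
have tau0 : 0 < (t - s) / T by apply: divr_gt0 => //; lra.
apply: (@continuous_comp _ _ _ (fun t => (t - s) / T) (fun x => x `^ a)).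
  apply: (@continuousM R R (fun t => t - s) (fun=> T^-1)); last exact: cst_continuous.
  apply: (@continuousB R R _ id (fun=> s)); last exact: cst_continuous.
  exact: (@cvg_id _ (nbhs t)).
apply: differentiable_continuous; apply/derivable1_diffP.
by apply: derivable_powR; rewrite in_itv/= tau0.
Qed.

(* Where [xi^2 <= eta tau] the derivative of [tau^(1-b) / 8] dominates; elsewhere
   the gradient term does, and [b = p / (2 (p - 1))] is the exponent for which
   both sides of that comparison scale in the same way. *)
Lemma power_barrier_strict (p A : R) : 2 < p -> 0 < A ->
  exists b K eps, [/\ 0 < b < 1, 4 <= K, 0 < eps <= 1 &
    forall tau xi, 0 < tau <= 1 -> 0 <= xi ->
    0 < (1 - b) / 8 * tau `^ (- b) - b * K * xi ^+ 2 * tau `^ (- b - 1)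
        + A^-1 * (2 * K * xi * tau `^ (- b)) `^ p
        - 2 * A * K * eps * tau `^ (- b) - A * eps].
Proof.
move=> p2 A0.
set b := p / (2 * (p - 1)).
have b0 : 0 < b by apply: divr_gt0; lra.
have b1 : b < 1 by rewrite ltr_pdivrMr; lra.
(* [c] is [eta ^ q], for the [eta] and [q] set below, stripped of its power of [K]. The bound
   [b * A / c <= K] lets the gradient term absorb the loss [b * K]; the bound [4 <= K] later lifts
   the barrier by [omega] at distance [r / 2]. *)
set c := ((1 - b) / (16 * b)) `^ ((p - 2) / 2).
have c0 : 0 < c by apply/powR_gt0/divr_gt0; lra.
set K := 4 + b * A / c.
have bAc : 0 < b * A / c by rewrite divr_gt0// mulr_gt0.
have K4 : 4 <= K by rewrite /K; lra.
have K0 : 0 < K by lra.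
(* Sized so that both error terms together stay below [(1 - b) / 32 * P]; the constant one is
   compared using [1 <= P]. *)
set D := 32 * (2 * A * K + A) + 1.
have D0 : 1 < D.
  by have : 0 < A * K by [exact: mulr_gt0]; rewrite /D; lra.
set e := (1 - b) / D.
have e0 : 0 < e by apply: divr_gt0; lra.
have eD : e * D = 1 - b by rewrite /e divfK// gt_eqF//; lra.
exists b, K, e; split=> //; first by rewrite b0.
  by rewrite e0 ler_pdivrMr; lra.
move=> tau xi /andP[tau0 tau1] xi0.
set P := tau `^ (- b).
have P1 : 1 <= P by apply: powRN_ge1; [exact: ltW|rewrite tau0].
have P0 : 0 < P by lra.
have errors : 2 * A * K * e * P + A * e <= (1 - b) / 32 * P.
  have h : 2 * A * K * e + A * e <= (1 - b) / 32 by move: eD; rewrite /D; lra.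
  have : A * e <= A * e * P by rewrite ler_peMr// mulr_ge0 ?ltW.
  by have := ler_wpM2r (ltW P0) h; lra.
suff main : b * K * xi ^+ 2 * tau `^ (- b - 1) <=
    (1 - b) / 16 * P + A^-1 * (2 * K * xi * P) `^ p.
  have : 0 < (1 - b) * P by rewrite mulr_gt0// subr_gt0.
  by lra.
set eta := (1 - b) / (16 * b * K).
have bK : 0 < b * K by exact: mulr_gt0.
have eta0 : 0 < eta by apply: divr_gt0; [rewrite subr_gt0|rewrite -mulrA; lra].
rewrite powR_subr1// -/P.
have [small|large] := leP (xi ^+ 2) (eta * tau).
  have -> : b * K * xi ^+ 2 * (P / tau) = b * K * (xi ^+ 2 / tau) * P.
    by field; rewrite gt_eqF.
  have : xi ^+ 2 / tau <= eta by rewrite ler_pdivrMr.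
  move=> /(ler_wpM2l (ltW (mulr_gt0 b0 K0))) /(ler_wpM2r (ltW P0)) /le_trans; apply.
  have -> : b * K * eta = (1 - b) / 16 by rewrite /eta; field; rewrite !gt_eqF.
  by rewrite lerDl mulr_ge0 ?powR_ge0 ?invr_ge0 ?ltW.
have xipos : 0 < xi.
  rewrite lt_neqAle xi0 andbT; apply/eqP => xi00; move: large.
  by rewrite -xi00 expr0n/= ltNge mulr_ge0 ?ltW.
apply: (@le_trans _ _ (A^-1 * (2 * K * xi * P) `^ p)); last first.
  by rewrite lerDr mulr_ge0 ?ltW//; lra.
set q := (p - 2) / 2.
have q0 : 0 <= q by rewrite /q; lra.
(* The right side is [c * K ^ (p / 2 + 1)], and [p > 2] makes this exponent exceed [2]. Hence a
   large [K] gains more in the gradient term than it loses in the linear term [b * K]. *)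
have Kq : c * K ^+ 2 <= K `^ p * eta `^ q.
  have -> : eta = (1 - b) / (16 * b) / K by rewrite /eta; field; rewrite !gt_eqF.
  rewrite powRM ?invr_ge0 ?(ltW K0)//; last by rewrite divr_ge0; lra.
  rewrite -/c -(powR_inv1 (ltW K0)) -powRrM (mulrCA _ c) -powRD; last first.
    by rewrite (gt_eqF K0) implybT.
  rewrite ler_wpM2l ?(ltW c0)// -powR_mulrn ?(ltW K0)// ler_powR//; first lra.
  by rewrite /q; lra.
have xiq : xi ^+ 2 * (eta * tau) `^ q <= xi `^ p.
  have -> : xi `^ p = xi ^+ 2 * (xi ^+ 2) `^ q.
    rewrite -(powR_mulrn _ xi0) -powRrM -powRD; last by rewrite (gt_eqF xipos) implybT.
    by congr (_ `^ _); rewrite /q; lra.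
  rewrite ler_wpM2l ?sqr_ge0// ge0_ler_powR// ?nnegrE ?sqr_ge0 ?ltW//.
  exact: mulr_gt0.
(* The value of [b] is the solution of [- b * p + q = - b - 1]. *)
have tauq : P `^ p * tau `^ q = tau `^ (- b - 1).
  rewrite /P -powRrM -powRD; last by rewrite (gt_eqF tau0) implybT.
  congr (_ `^ _); rewrite /q /b; field; lra.
have KP0 : 0 <= K * P by rewrite mulr_ge0 ?ltW.
have step : c * K ^+ 2 * xi ^+ 2 * tau `^ (- b - 1) <= (2 * K * xi * P) `^ p.
  apply: (@le_trans _ _ ((K * P * xi) `^ p)); last first.
    have KPxi : 0 <= K * P * xi by rewrite mulr_ge0.
    have -> : 2 * K * xi * P = 2 * (K * P * xi) by ring.
    by apply: ge0_ler_powR; rewrite ?nnegrE; clear - p2 KPxi; lra.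
  rewrite powRM// powRM ?(ltW K0) ?(ltW P0)//.
  apply: (@le_trans _ _ (K `^ p * P `^ p * (xi ^+ 2 * (eta * tau) `^ q))); last first.
    by rewrite ler_wpM2l// mulr_ge0 ?powR_ge0.
  rewrite powRM ?(ltW eta0) ?(ltW tau0)//.
  have -> : K `^ p * P `^ p * (xi ^+ 2 * (eta `^ q * tau `^ q)) =
    K `^ p * eta `^ q * (xi ^+ 2 * (P `^ p * tau `^ q)) by ring.
  by rewrite tauq -mulrA ler_wpM2r// mulr_ge0 ?sqr_ge0 ?powR_ge0.
apply: (@le_trans _ _ (A^-1 * (c * K ^+ 2 * xi ^+ 2 * tau `^ (- b - 1)))); last first.
  by rewrite ler_wpM2l// invr_ge0 ltW.
have -> : P / tau = tau `^ (- b - 1) by rewrite powR_subr1.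
rewrite (_ : A^-1 * _ = A^-1 * c * K ^+ 2 * xi ^+ 2 * tau `^ (- b - 1)); last by ring.
rewrite !ler_wpM2r ?powR_ge0 ?sqr_ge0// expr2 mulrA ler_wpM2r ?(ltW K0)//.
have : b * A / c <= K by rewrite /K; lra.
by rewrite ler_pdivrMr// => h; rewrite -mulrA -ler_pdivrMl ?invr_gt0// invrK; clear - h; lra.
Qed.

End power_barrier.

(** * Propagation of a low value from one point *)

Section upper_improvement.
Context {R : realType}.

Lemma cylinder_continuity (d : nat) (w : 'rV[R]_d * R -> R) (y : 'rV[R]_d) (s eps : R) :
  {within cylinder d 1 0 1, continuous w} -> cylinder d 1 0 1 (y, s) -> 0 < eps ->
  exists2 delta, 0 < delta & forall x t, enorm (x - y) < delta -> `|t - s| < delta ->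
    cylinder d 1 0 1 (x, t) -> `|w (x, t) - w (y, s)| < eps.
Proof.
move=> /subspace_continuousP cw Qys eps0.
have /cvgrPdist_lt /(_ _ eps0) := cw _ Qys.
rewrite /within/= => -[[U V] [/= /nbhs_ballP[a a0 aU] /nbhs_ballP[b b0 bV]] UV].
exists (Num.min a b); first by rewrite lt_min a0.
move=> x t; rewrite !lt_min => /andP[xa _] /andP[_ tb] Qxt.
rewrite distrC; apply: (UV (x, t)) => //; split=> /=.
  apply: aU; split=> // i j; rewrite /ball/= (ord1 i).
  have := coord_le_enorm (y - x) j; rewrite enormB !mxE => /le_lt_trans; exact.
by apply: bV; rewrite /ball/= distrC.
Qed.

(** Provides the rescaled time at which the comparison with the singular barrier starts: late enough
    to stay finite, early enough that the barrier is already high at distance [delta] from its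
    centre. *)
Lemma powRN_blowup (b k T delta : R) : 0 < b -> 0 < k -> 0 < T -> 0 < delta ->
  exists eta, [/\ 0 < eta, eta < 3 / 4, eta * T < delta & 1 <= k * eta `^ (- b)].
Proof.
move=> b0 k0 T0 delta0.
set eta := Num.min (Num.min 2^-1 (delta / (2 * T))) (k `^ b^-1).
have k1 : 0 < k `^ b^-1 by exact: powR_gt0.
have dT : 0 < delta / (2 * T) by rewrite divr_gt0// mulr_gt0.
have eta0 : 0 < eta by rewrite !lt_min k1 dT invr_gt0 ltr0n.
have [eta1 eta2 eta3] : [/\ eta <= 2^-1, eta <= delta / (2 * T) & eta <= k `^ b^-1].
  by split; rewrite /eta !ge_min lexx ?orbT.
exists eta; split=> //; first by lra.
  by move: eta2; rewrite ler_pdivlMr ?mulr_gt0//; lra.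
rewrite powRN ler_pdivlMr ?powR_gt0// mul1r.
have : eta `^ b <= (k `^ b^-1) `^ b.
  exact: (ge0_ler_powR (ltW b0) (ltW eta0) (ltW k1) eta3).
by rewrite -powRrM mulVf ?(gt_eqF b0)// powRr1// ltW.
Qed.

(** With [tau = (t - s) / T], the barrier is [m + 5/8 omega + omega/8 tau^(1-b) + K omega (|x - y| /
    r)^2 tau^(-b)]. At the starting time, continuity at [(y, s)] gives [w <= m + 5/8 omega] near
    [y], and farther out the singular term exceeds [omega]. The starting time depends on [w], the
    resulting bound does not. For [tau >= 3/4] one has [tau^(-b) <= 2], whence the factor
    [2 * K]. *)
Lemma upper_improvement (p A : R) : 2 < p -> 0 < A -> exists K eps, [/\ 4 <= K, 0 < eps <= 1 &
  forall d (w : 'rV[R]_d * R -> R) (y : 'rV[R]_d) (r omega T s m : R),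
    quadratic_subsolution A^-1 p A w -> {within cylinder d 1 0 1, continuous w} ->
    0 < r -> 0 < omega -> 0 < T -> 0 <= s -> s + T <= 1 ->
    (omega / r) `^ p * T = omega -> T <= eps * r ^+ 2 -> T <= eps * omega ->
    (forall x, enorm (x - y) <= r / 2 -> enorm x < 1) ->
    (forall x t, enorm (x - y) <= r / 2 -> s <= t < s + T -> w (x, t) <= m + omega) ->
    w (y, s) <= m + omega / 2 ->
    forall x t, enorm (x - y) <= r / 2 -> s + 3 / 4 * T <= t < s + T ->
      w (x, t) <= m + 3 / 4 * omega + 2 * K * omega * (enorm (x - y) / r) ^+ 2].
Proof.
move=> p2 A0; have [b [K [eps [/andP[b0 b1] K4 eps01 strict]]]] := power_barrier_strict p2 A0.
exists K, eps; split=> // d w y r omega T s m subw cw r0 omega0 T0 s0 sT scal Tr Tomega ball wle wy.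
have Qys : cylinder d 1 0 1 (y, s).
  apply: cylinder_center; last by lra.
  by apply: ball; rewrite subrr enorm0; lra.
have omega8 : 0 < omega / 8 by lra.
have [delta delta0 near_y] := cylinder_continuity cw Qys omega8.
have k0 : 0 < K * (delta / r) ^+ 2.
  by apply: mulr_gt0; [lra|rewrite exprn_gt0// divr_gt0].
have [eta [eta0 eta34 etaT eta1]] := powRN_blowup b0 k0 T0 delta0.
set s' := s + eta * T.
have ss' : s < s' by rewrite /s' ltrDl mulr_gt0.
set f := fun t => (m + 5 / 8 * omega) + omega / 8 * ((t - s) / T) `^ (1 - b).
set g := fun t => omega * K / r ^+ 2 * ((t - s) / T) `^ (- b).
set f1 := fun t => omega / 8 * ((1 - b) * ((t - s) / T) `^ ((1 - b) - 1) / T).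
set g1 := fun t => omega * K / r ^+ 2 * (- b * ((t - s) / T) `^ (- b - 1) / T).
have b1' : 0 < 1 - b by clear - b1; lra.
have b1'' : 1 - b < 1 by clear - b0; lra.
have K0 : 0 < K by clear - K4; lra.
have gK : 0 <= omega * K / r ^+ 2.
  by rewrite divr_ge0 ?sqr_ge0// mulr_ge0 ?ltW.
have tauP t : s' <= t < s + T -> 0 < (t - s) / T <= 1.
  by move=> tt; rewrite divr_gt0 ?ler_pdivrMr//; clear - tt ss' T0; lra.
move=> x t xr tt.
have st : s' <= t < s + T.
  have : eta * T <= 3 / 4 * T by rewrite ler_wpM2r ?ltW.
  by rewrite /s'; clear - tt; lra.
have s'T : s' < s + T by clear - st; lra.
have fg : w (x, t) <= f t + g t * enorm (x - y) ^+ 2.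
  apply: (comparison (f1 := f1) (g1 := g1) subw cw _ sT ball) xr st.
  - by clear - s0 ss'; lra.
  - move=> t1 t1s; apply: (@continuousD R R _ (fun=> _)); first exact: cst_continuous.
    apply: (@continuousM R R (fun=> _)); first exact: cst_continuous.
    by apply: continuous_powR_rescaled => //; clear - t1s ss'; lra.
  - move=> t1 t1s; apply: (@continuousM R R (fun=> _)); first exact: cst_continuous.
    by apply: continuous_powR_rescaled => //; clear - t1s ss'; lra.
  - move=> t1 t1s; rewrite -[f1 t1]add0r; apply: quadratic_majorantD.
      by exists 0, 1; split=> // e _; rewrite !mul0r !addr0.
    apply: quadratic_majorantZ; first exact: ltW.
    by apply: quadratic_majorant_powR => //; clear - t1s ss'; lra.
  - move=> t1 t1s; apply: quadratic_majorantZ => //.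
    by apply: quadratic_majorant_powRN => //; clear - t1s ss'; lra.
  - by move=> t1 _; rewrite mulr_ge0 ?powR_ge0.
  - move=> t1 rho t1s /andP[rho0 _].
    have tau01 : 0 < (t1 - s) / T <= 1 by apply: tauP; clear - t1s; lra.
    have xi0 : 0 <= rho / r by rewrite divr_ge0// ltW.
    have := strict _ _ tau01 xi0.
    rewrite /f1 /g1 /g (_ : 1 - b - 1 = - b); last by ring.
    set tau := (t1 - s) / T; set P := tau `^ (- b); set P1 := tau `^ (- b - 1).
    have -> : 2 * (omega * K / r ^+ 2 * P) * rho = 2 * K * (rho / r) * P * (omega / r).
      by field; rewrite gt_eqF.
    rewrite (@powRM _ _ (omega / r)); last 2 first.
    + by rewrite mulr_ge0 ?powR_ge0// mulr_ge0// mulr_ge0// ltW.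
    + by rewrite divr_ge0// ltW.
    (* The scaling relation makes the required inequality [omega / T] times the rescaled one, up to
       the Hessian and constant terms, which the two bounds on [T] control. *)
    have -> : (omega / r) `^ p = omega / T.
      by apply: (canRL (mulfK _) scal); rewrite gt_eqF.
    set G := (_ `^ p).
    set S := (X in 0 < X -> _) => S0.
    have P0 : 0 <= P by exact: powR_ge0.
    have {S0} : 0 < omega / T * S by rewrite mulr_gt0// divr_gt0.
    have e1 : 2 * A * K * omega * P * (T / r ^+ 2) / T <= 2 * A * K * omega * P * eps / T.
      rewrite ler_pM2r ?invr_gt0// ler_wpM2l ?ler_pdivrMr ?exprn_gt0//.
      by rewrite !mulr_ge0 ?ler0n ?(ltW A0) ?(ltW K0) ?(ltW omega0).
    have e2 : A * T / T <= A * (eps * omega) / T.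
      by rewrite ler_pM2r ?invr_gt0// ler_wpM2l// ltW.
    move=> S0; set target := (X in 0 < X).
    have -> : target = omega / T * S
      + (2 * A * K * omega * P * eps / T - 2 * A * K * omega * P * (T / r ^+ 2) / T)
      + (A * (eps * omega) / T - A * T / T).
      by rewrite /target /S; field; rewrite !gt_eqF.
    by clear - S0 e1 e2; lra.
  - move=> z zr.
    have tau' : (s' - s) / T = eta by rewrite /s' addrC addKr mulfK// gt_eqF.
    have gs' : g s' = omega * K / r ^+ 2 * eta `^ (- b) by rewrite /g tau'.
    have g0 : 0 <= g s' * enorm (z - y) ^+ 2.
      by rewrite mulr_ge0 ?sqr_ge0// gs' mulr_ge0// powR_ge0.
    have fs' : m + 5 / 8 * omega <= f s'.
      by rewrite /f lerDl mulr_ge0 ?powR_ge0// ltW.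
    have s'1 : 0 <= s' <= 1 by clear - ss' s'T s0 sT; lra.
    have [zd|zd] := ltP (enorm (z - y)) delta.
      have ds : `|s' - s| < delta by rewrite /s' addrC addKr gtr0_norm// mulr_gt0.
      have := near_y z s' zd ds (cylinder_center (ball _ zr) s'1).
      by rewrite ltr_norml => /andP[_ uz]; clear - uz wy g0 fs'; lra.
    have ss'T : s <= s' < s + T by clear - ss' s'T; lra.
    have := wle z s' zr ss'T.
    suff : omega <= g s' * enorm (z - y) ^+ 2 by clear - fs' omega0; lra.
    have z2 : delta ^+ 2 <= enorm (z - y) ^+ 2 by rewrite ler_sqr ?nnegrE ?enorm_ge0// ltW.
    have gs0 : 0 <= g s' by rewrite gs' mulr_ge0// powR_ge0.
    apply: (le_trans _ (ler_wpM2l gs0 z2)).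
    have -> : g s' * delta ^+ 2 = omega * (K * (delta / r) ^+ 2 * eta `^ (- b)).
      by rewrite gs'; field; rewrite gt_eqF.
    by rewrite ler_peMr// ltW.
  - move=> z t1 zr t1s.
    have tau01 : 0 < (t1 - s) / T <= 1 by apply: tauP; clear - t1s; lra.
    have zr' : enorm (z - y) <= r / 2 by rewrite zr.
    have t1T : s <= t1 < s + T by clear - t1s ss'; lra.
    have := wle z t1 zr' t1T.
    have : m + 5 / 8 * omega <= f t1.
      by rewrite /f lerDl mulr_ge0 ?powR_ge0// ltW.
    suff : omega <= g t1 * (r / 2) ^+ 2 by clear - omega0; lra.
    have -> : g t1 * (r / 2) ^+ 2 = omega * (K / 4 * ((t1 - s) / T) `^ (- b)).
      by rewrite /g; field; rewrite gt_eqF.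
    rewrite ler_peMr ?(ltW omega0)// mulr_ege1//; first by clear - K4; lra.
    by apply: powRN_ge1 => //; exact: ltW.
apply: (le_trans fg).
have tau01 : 0 < (t - s) / T <= 1 by exact: tauP.
have tau34 : 3 / 4 <= (t - s) / T by rewrite ler_pdivlMr//; clear - tt; lra.
rewrite /f /g; set tau := (t - s) / T in tau01 tau34 *.
have f1le : tau `^ (1 - b) <= 1 by apply: powR_le1; clear - b1 tau01; lra.
have tau0 : 0 < tau by clear - tau34; lra.
have tauN : tau `^ (- b) <= 2.
  rewrite powRN -[leRHS]invrK lef_pV2 ?posrE ?powR_gt0 ?invr_gt0//.
  by apply: le_trans (ger1_powR tau01 (ltW b1)); clear - tau34; lra.
have := ler_wpM2l (ltW omega8) f1le.
have e0 : 0 <= omega * K / r ^+ 2 * enorm (x - y) ^+ 2 by rewrite mulr_ge0// sqr_ge0.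
have := ler_wpM2l e0 tauN.
have -> : omega * K / r ^+ 2 * enorm (x - y) ^+ 2 * 2 =
  2 * K * omega * (enorm (x - y) / r) ^+ 2 by field; rewrite gt_eqF.
by clear - omega0; lra.
Qed.

End upper_improvement.

(** * Raising the infimum *)

Section lower_improvement.
Context {R : realType}.

(** Here [v] plays the role of [- u]. The barrier starts at [m - theta omega], rises by
    [theta omega / 4] over time [T], and has a spatial part equal to [theta omega] on the sphere of
    radius [c r], so it is at least [m] there. On the half ball the spatial part is at most
    [theta omega / 4], which leaves a gain of [theta omega / 2]. *)
Lemma lower_improvement (p A c : R) : 2 < p -> 0 < A -> 0 < c ->
  exists theta eps, [/\ 0 < theta <= 8^-1, 0 < eps <= 1 &
  forall d (v : 'rV[R]_d * R -> R) (x0 : 'rV[R]_d) (r omega T s m : R),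
    quadratic_subsolution (- A) p A v -> {within cylinder d 1 0 1, continuous v} ->
    0 < r -> 0 < omega -> 0 < T -> 0 <= s -> s + T <= 1 ->
    (omega / r) `^ p * T = omega -> T <= eps * r ^+ 2 -> T <= eps * omega ->
    (forall x, enorm (x - x0) <= c * r -> enorm x < 1) ->
    (forall x t, enorm (x - x0) <= c * r -> s <= t < s + T -> v (x, t) <= m) ->
    (forall x, enorm (x - x0) <= c * r -> v (x, s) <= m - omega / 2) ->
    forall x t, enorm (x - x0) <= c * r / 2 -> s <= t < s + T ->
      v (x, t) <= m - theta / 2 * omega].
Proof.
move=> p2 A0 c0; set B := 2 / c.
have B0 : 0 < B by apply: divr_gt0.
have AB0 : 0 < A * B ^+ 2 by rewrite mulr_gt0// exprn_gt0.
(* The three summands give [theta <= 1/8], [theta * B <= 1] and [theta * A * B^2 <= 1/16]. The last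
   two make the gradient cost [A * (theta * B)^p] at most [theta / 16], below the time slope
   [theta / 4]. *)
set D := 8 + B + 16 * (A * B ^+ 2).
have D8 : 8 <= D by rewrite /D; lra.
have D0 : 0 < D by lra.
set theta := D^-1.
have theta0 : 0 < theta by rewrite invr_gt0.
have theta8 : theta <= 8^-1 by rewrite lef_pV2 ?posrE.
have thetaD : theta * D = 1 by rewrite mulVf// gt_eqF.
set D' := 16 * (A * B ^+ 2 + A) + 1.
have D'1 : 1 < D' by rewrite /D'; lra.
set eps := theta / D'.
have eps0 : 0 < eps by apply: divr_gt0 => //; lra.
have epsD' : eps * D' = theta by rewrite divfK// gt_eqF//; lra.
have strict : 0 < theta / 4 - A * (theta * B) `^ p
    - A * B ^+ 2 / 2 * theta * eps - A * eps.
  have tB0 : 0 < theta * B by exact: mulr_gt0.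
  have tAB : 0 < theta * (A * B ^+ 2) by exact: mulr_gt0.
  have tB1 : theta * B <= 1 by move: thetaD; rewrite /D !mulrDr; lra.
  have : (theta * B) `^ p <= (theta * B) ^+ 2.
    by rewrite -powR_mulrn ?(ltW tB0)// ger_powR ?tB0//; lra.
  move=> /(ler_wpM2l (ltW A0)).
  have : A * (theta * B) ^+ 2 <= theta / 16.
    have -> : A * (theta * B) ^+ 2 = theta * (theta * (A * B ^+ 2)) by ring.
    by rewrite ler_pM2l//; move: thetaD; rewrite /D !mulrDr; lra.
  have : eps * (A * B ^+ 2) * theta <= eps * (A * B ^+ 2).
    by rewrite ler_piMr; [| |lra]; rewrite // mulr_ge0 ?ltW.
  have : 0 < eps * (A * B ^+ 2) by exact: mulr_gt0.
  by move: epsD'; rewrite /D' !mulrDr; lra.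
exists theta, eps; split; first by rewrite theta0.
  by rewrite eps0 ler_pdivrMr; lra.
move=> d v x0 r omega T s m subv cv r0 omega0 T0 s0 sT scal Tr Tomega ball vle vs x t xr st.
have cr0 : 0 < c * r by exact: mulr_gt0.
set k := theta * omega / (4 * T).
have to0 : 0 < theta * omega by exact: mulr_gt0.
have k0 : 0 < k by rewrite divr_gt0// mulr_gt0.
have kT : k * T = theta * omega / 4 by rewrite /k; field; rewrite gt_eqF.
set f := fun t => (m - theta * omega - k * s) + k * t.
set G := theta * omega / (c * r) ^+ 2.
have G0 : 0 < G by rewrite divr_gt0// exprn_gt0.
have Gcr : G * (c * r) ^+ 2 = theta * omega by rewrite /G divfK// gt_eqF ?exprn_gt0.
have fs t1 : s <= t1 -> m - theta * omega <= f t1.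
  move=> st1; have : 0 <= k * (t1 - s) by rewrite mulr_ge0 ?(ltW k0)// subr_ge0.
  by rewrite mulrBr /f; clear - k0; lra.
have xr' : enorm (x - x0) <= c * r by lra.
have fg : v (x, t) <= f t + G * enorm (x - x0) ^+ 2.
  apply: (comparison (g := fun=> G) (f1 := fun=> k) (g1 := fun=> 0) subv cv s0 sT ball) xr' st.
  - move=> t1 _; apply: (@continuousD R R _ (fun=> _)); first exact: cst_continuous.
    apply: (@continuousM R R (fun=> _)); first exact: cst_continuous.
    exact: (@cvg_id _ (nbhs t1)).
  - by move=> t1 _; exact: cst_continuous.
  - by move=> t1 _; exact: quadratic_majorant_affine.
  - by move=> t1 _; exists 0, 1; split=> // e _; rewrite !mul0r !addr0.
  - by move=> _ _; exact: ltW.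
  - move=> t1 rho _ /andP[rho0 rhor]; rewrite mul0r addr0.
    have Grho : (2 * G * rho) `^ p <= (theta * B) `^ p * (omega / T).
      have -> : omega / T = (omega / r) `^ p.
        by apply/esym/(canRL (mulfK _) scal); rewrite gt_eqF.
      have tB0 : 0 <= theta * B by rewrite mulr_ge0// ltW.
      have or0 : 0 <= omega / r by rewrite divr_ge0// ltW.
      have p0 : 0 <= p by clear - p2; lra.
      have G2 : 0 <= 2 * G by rewrite mulr_ge0// ltW.
      rewrite -powRM//; apply: (ge0_ler_powR p0); rewrite ?nnegrE.
      - exact: mulr_ge0.
      - exact: mulr_ge0.
      have -> : theta * B * (omega / r) = 2 * G * (c * r).
        by rewrite /B /G; field; rewrite !gt_eqF.
      by rewrite ler_wpM2l// ltW.
    have oT0 : 0 < omega / T by rewrite divr_gt0.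
    have := mulr_gt0 oT0 strict.
    have := ler_wpM2l (ltW A0) Grho.
    have e1 : A * G * 2 <= A * B ^+ 2 / 2 * theta * eps * (omega / T).
      have -> : A * G * 2 = A * B ^+ 2 / 2 * theta * (omega / T) * (T / r ^+ 2).
        by rewrite /G /B; field; rewrite !gt_eqF.
      rewrite [leRHS]mulrAC ler_wpM2l// ?ler_pdivrMr ?exprn_gt0//.
      apply: mulr_ge0; last exact: ltW.
      by apply: mulr_ge0; [clear - AB0; lra|exact: ltW].
    have e2 : A <= A * eps * (omega / T).
      have h : 1 <= eps * (omega / T) by rewrite mulrA ler_pdivlMr// mul1r.
      by rewrite -mulrA; apply: ler_peMr => //; exact: ltW.
    have kE : k = omega / T * (theta / 4) by rewrite /k; field; rewrite gt_eqF.
    by rewrite kE; clear - e1 e2; lra.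
  - move=> z zr; have := vs z zr; have := fs s (lexx s).
    have : 0 <= G * enorm (z - x0) ^+ 2 by rewrite mulr_ge0 ?sqr_ge0 ?(ltW G0).
    have : theta * omega <= 8^-1 * omega by rewrite ler_pM2r.
    by lra.
  - move=> z t1 zr /andP[st1 t1T]; rewrite Gcr.
    have := fs _ st1.
    have zr' : enorm (z - x0) <= c * r by rewrite zr.
    by have := vle z t1 zr' (introT andP (conj st1 t1T)); lra.
apply: (le_trans fg).
have : enorm (x - x0) ^+ 2 <= (c * r / 2) ^+ 2.
  by rewrite ler_sqr ?nnegrE ?enorm_ge0//; lra.
move=> /(ler_wpM2l (ltW G0)).
have -> : G * (c * r / 2) ^+ 2 = theta * omega / 4 by rewrite -Gcr; field.
have : k * (t - s) <= k * T by rewrite ler_pM2l//; lra.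
by rewrite kT /f mulrBr; lra.
Qed.

End lower_improvement.

(** * Decrease of the oscillation in one cylinder *)

Section oscillation_decay.
Context {R : realType}.

Definition oscillates_within (d : nat) (u : 'rV[R]_d * R -> R) (x0 : 'rV[R]_d)
    (t0 r T omega : R) : Prop :=
  exists m, forall x t, enorm (x - x0) < r -> t0 - T <= t < t0 ->
    m <= u (x, t) <= m + omega.

(* Either [u] is below its median level somewhere at the bottom of the cylinder,
   and this propagates from one point since the equation is superlinear in the
   gradient, or it stays above that level on a ball of radius [c r]. *)
Lemma oscillation_decay (p A : R) : 2 < p -> 0 < A ->
  exists c theta eps, [/\ 0 < c <= 8^-1, 0 < theta <= 8^-1, 0 < eps <= 1 &
  forall d (u : 'rV[R]_d * R -> R) (x0 : 'rV[R]_d) (t0 r omega T : R),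
    quadratic_subsolution A^-1 p A u ->
    quadratic_subsolution (- A) p A (fun z => - u z) ->
    {within cylinder d 1 0 1, continuous u} ->
    0 < r -> 0 < omega -> 0 < T -> T <= t0 -> t0 <= 1 ->
    (omega / r) `^ p * T = omega -> T <= eps * r ^+ 2 -> T <= eps * omega ->
    (forall x, enorm (x - x0) < r -> enorm x < 1) ->
    oscillates_within u x0 t0 r T omega ->
    oscillates_within u x0 t0 (c / 2 * r) (T / 4) ((1 - theta) * omega)].
Proof.
move=> p2 A0; have [K [eps1 [K4 /andP[eps10 eps11] upper]]] := upper_improvement p2 A0.
(* Points of the smaller ball lie within [2 c r] of the low point, where the quadratic term
   [2 K omega (2 c)^2] equals [c * omega], at most [omega / 8]. *)
set c := (8 * K)^-1.
have c0 : 0 < c by rewrite invr_gt0; lra.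
have cK : 8 * K * c = 1 by rewrite mulfV// gt_eqF//; lra.
have c8 : c <= 8^-1 by rewrite lef_pV2 ?posrE; lra.
have [theta [eps2 [/andP[theta0 theta8] /andP[eps20 eps21] lower]]] :=
  lower_improvement p2 A0 c0.
exists c, (theta / 2), (Num.min eps1 eps2); split.
- by rewrite c0.
- lra.
- by rewrite lt_min eps10 eps20 ge_min eps11.
move=> d u x0 t0 r omega T subu supu cu r0 omega0 T0 Tt0 t01 scal Tr Tomega ball [m um].
have cr0 : 0 < c * r by exact: mulr_gt0.
have cr8 : c * r <= 8^-1 * r by rewrite ler_pM2r.
have s0 : 0 <= t0 - T by lra.
have sT : t0 - T + T <= 1 by clear - t01; lra.
have [Tr1 Tr2] : T <= eps1 * r ^+ 2 /\ T <= eps2 * r ^+ 2.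
  by split; apply: (le_trans Tr); rewrite ler_wpM2r ?sqr_ge0// ge_min lexx ?orbT.
have [To1 To2] : T <= eps1 * omega /\ T <= eps2 * omega.
  by split; apply: (le_trans Tomega); rewrite ler_pM2r// ge_min lexx ?orbT.
have [[y [yx0 uy]]|high] := pselect (exists y, enorm (y - x0) <= c * r /\
    u (y, t0 - T) <= m + omega / 2).
  have near_x0 x : enorm (x - y) <= r / 2 -> enorm (x - x0) < r.
    have := enormD (x - y) (y - x0); rewrite addrA subrK; clear - yx0 cr8 r0; lra.
  have ball' x : enorm (x - y) <= r / 2 -> enorm x < 1 by move=> /near_x0 /ball.
  have bnd x t : enorm (x - y) <= r / 2 -> t0 - T <= t < t0 - T + T ->
      u (x, t) <= m + omega.
    by rewrite subrK => /near_x0 xr tt; have /andP[] := um _ _ xr tt.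
  exists m => x t xr tt.
  have xr1 : enorm (x - x0) < r by clear - xr cr8 r0; lra.
  have tt1 : t0 - T <= t < t0 by clear - tt T0; lra.
  have /andP[-> _] /= := um _ _ xr1 tt1.
  have xy : enorm (x - y) <= 2 * c * r.
    have := enormD (x - x0) (x0 - y); rewrite addrA subrK (enormB x0); clear - yx0 xr cr0; lra.
  have xy2 : enorm (x - y) <= r / 2 by clear - xy cr8 r0; lra.
  have tt2 : t0 - T + 3 / 4 * T <= t < t0 - T + T by clear - tt; lra.
  have := upper d u y r omega T (t0 - T) m subu cu r0 omega0 T0 s0 sT scal Tr1 To1
    ball' bnd uy x t xy2 tt2.
  move=> /le_trans; apply.
  have : (enorm (x - y) / r) ^+ 2 <= (2 * c) ^+ 2.
    rewrite ler_sqr ?nnegrE ?divr_ge0 ?enorm_ge0 ?(ltW r0)//; last by clear - K4; lra.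
    by rewrite ler_pdivrMr.
  have K0 : 0 <= 2 * K * omega by apply: mulr_ge0; clear - K4 omega0; lra.
  move=> /(ler_wpM2l K0).
  have -> : 2 * K * omega * (2 * c) ^+ 2 = 8 * K * c * (c * omega) by ring.
  rewrite cK mul1r.
  have : c * omega <= 8^-1 * omega by rewrite ler_pM2r.
  have : theta * omega <= 8^-1 * omega by rewrite ler_pM2r.
  by clear - omega0; lra.
have bnd x t : enorm (x - x0) <= c * r -> t0 - T <= t < t0 - T + T ->
    - u (x, t) <= - m.
  rewrite subrK => xr tt; have xr1 : enorm (x - x0) < r by clear - xr cr8 r0; lra.
  by have /andP[? _] := um _ _ xr1 tt; rewrite lerN2.
have bottom x : enorm (x - x0) <= c * r -> - u (x, t0 - T) <= - m - omega / 2.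
  move=> xr; rewrite leNgt; apply/negP => ux; apply: high; exists x; split=> //; clear - ux; lra.
have cv : {within cylinder d 1 0 1, continuous (fun z => - u z)}.
  by move=> z; apply: cvgN; exact: cu.
have ball' x : enorm (x - x0) <= c * r -> enorm x < 1.
  by move=> xr; apply: ball; clear - xr cr8 r0; lra.
exists (m + theta / 2 * omega) => x t xr tt.
have xr1 : enorm (x - x0) < r by clear - xr cr8 r0; lra.
have tt1 : t0 - T <= t < t0 by clear - tt T0; lra.
have /andP[_ ux] := um _ _ xr1 tt1.
have xr2 : enorm (x - x0) <= c * r / 2 by clear - xr; lra.
have tt2 : t0 - T <= t < t0 - T + T by clear - tt T0; lra.
have := lower d (fun z => - u z) x0 r omega T (t0 - T) (- m) supu cv r0 omega0 T0 s0 sT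
  scal Tr2 To2 ball' bnd bottom x t xr2 tt2.
by clear - ux; lra.
Qed.

End oscillation_decay.

(** * Iteration over shrinking cylinders *)

Section oscillation_iteration.
Context {R : realType}.

Lemma oscillates_within_sub (d : nat) (u : 'rV[R]_d * R -> R) x0 t0 r r' T T' omega :
  r' <= r -> T' <= T -> oscillates_within u x0 t0 r T omega ->
  oscillates_within u x0 t0 r' T' omega.
Proof.
move=> rr TT [m um]; exists m => x t xr tt; apply: um; first exact: lt_le_trans rr.
lra.
Qed.

(** Preserving the scaling relation forces [sigma] once [rho] is chosen: [rho = q (1 - theta)] gives
    [sigma = q^p (1 - theta)]. Then [sigma <= rho^2] amounts to [q^(p-2) <= 1 - theta], which a
    small [q] achieves because [p > 2]. This keeps [T / r^2] from growing, and [sigma < 1 - theta]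
    does the same for [T / omega]. *)
Lemma contraction_factors (p c theta : R) : 2 < p -> 0 < c <= 8^-1 -> 0 < theta <= 8^-1 ->
  exists rho sigma, [/\ 0 < rho <= c / 2, 0 < sigma <= 4^-1, sigma <= rho ^+ 2,
    sigma < 1 - theta & ((1 - theta) / rho) `^ p * sigma = 1 - theta].
Proof.
move=> p2 /andP[c0 c8] /andP[theta0 theta8].
have th : 0 < 1 - theta by lra.
set q := Num.min (c / 2) ((1 - theta) `^ (p - 2)^-1).
have c2 : 0 < c / 2 by lra.
have q0 : 0 < q by rewrite lt_min c2 powR_gt0.
have qc : q <= c / 2 by rewrite /q ge_min lexx.
have qp : q `^ (p - 2) <= 1 - theta.
  have p20 : 0 <= p - 2 by lra.
  have : q <= (1 - theta) `^ (p - 2)^-1 by rewrite /q ge_min lexx orbT.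
  move=> /(ge0_ler_powR p20 (ltW q0) (powR_ge0 _ _)).
  have p2n : p - 2 != 0 by rewrite gt_eqF// subr_gt0.
  by rewrite -powRrM mulVf// powRr1// ltW.
exists (q * (1 - theta)), (q `^ p * (1 - theta)).
have sr : q `^ p * (1 - theta) <= (q * (1 - theta)) ^+ 2.
  have -> : q `^ p = q ^+ 2 * q `^ (p - 2).
    by rewrite -powR_mulrn ?(ltW q0)// -powRD ?subrKC// (gt_eqF q0) implybT.
  rewrite exprMn -mulrA ler_wpM2l ?sqr_ge0// expr2 ler_pM2r//.
have q16 : q <= 16^-1 by lra.
have rho0 : 0 < q * (1 - theta) by exact: mulr_gt0.
have rhoq : q * (1 - theta) <= q by rewrite ler_piMr ?(ltW q0)//; lra.
have rho4 : (q * (1 - theta)) ^+ 2 <= 4^-1.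
  have : (q * (1 - theta)) ^+ 2 <= q * (1 - theta) * 1 by rewrite expr2 ler_pM2l//; lra.
  by lra.
split=> //.
- by rewrite rho0; lra.
- by rewrite mulr_gt0 ?powR_gt0//=; apply: le_trans rho4.
- by apply: (le_lt_trans (le_trans sr rho4)); lra.
have -> : (1 - theta) / (q * (1 - theta)) = q^-1.
  by rewrite invfM mulrCA mulfV ?mulr1 ?(gt_eqF th).
rewrite mulrA -powRM ?invr_ge0 ?(ltW q0)// mulVf ?gt_eqF// powR1 mul1r//.
Qed.

(** [omega0] need only bound the oscillation, so it may be enlarged until the first cylinder, of
    radius [1/2], satisfies the smallness conditions on [T]. The proof takes [theta] and [sigma]
    from [p] and [A] alone; [M] enters through [omega0] and [T0]. *)
Lemma oscillation_geometric (p A M : R) : 2 < p -> 0 < A ->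
  exists theta sigma omega0 T0 : R, [/\ 0 < theta, 0 < sigma < 1 - theta,
    2 * `|M| <= omega0, 0 < T0 <= 2^-1 &
  forall d (u : 'rV[R]_d * R -> R),
    quadratic_subsolution A^-1 p A u ->
    quadratic_subsolution (- A) p A (fun z => - u z) ->
    {within cylinder d 1 0 1, continuous u} ->
    (forall z, cylinder d 1 0 1 z -> `|u z| <= M) ->
    forall k x0 t0, enorm x0 < 2^-1 -> 2^-1 <= t0 <= 1 ->
    oscillates_within u x0 t0 (sigma ^+ k * T0) (sigma ^+ k * T0)
      ((1 - theta) ^+ k * omega0)].
Proof.
move=> p2 A0.
have [c [theta [eps [c08 theta08 /andP[eps0 eps1] decay]]]] := oscillation_decay p2 A0.
have [rho [sigma [/andP[rho0 rhoc] /andP[sigma0 sigma4] sr st scal]]] :=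
  contraction_factors p2 c08 theta08.
have /andP[c0 c8] := c08; have /andP[theta0 theta8] := theta08.
have th0 : 0 < 1 - theta by lra.
set omega0 := 2 * `|M| + 1 + eps^-1.
have ieps : 1 <= eps^-1 by rewrite invf_ge1.
have M0 : 0 <= `|M| by [].
have omega1 : 1 <= omega0 by rewrite /omega0; lra.
have omegapos : 0 < omega0 by lra.
set S := (omega0 / 2^-1) `^ p.
have S0 : 0 < S by apply: powR_gt0; lra.
(* As [p > 2], the height [T0] is at most [1 / (4 * omega0)], and the summand [eps^-1] of [omega0]
   turns this into [T0 <= eps / 4], the bound [eps * r^2] at [r = 1/2]. *)
have S2 : 4 * omega0 ^+ 2 <= S.
  have -> : 4 * omega0 ^+ 2 = (omega0 / 2^-1) `^ 2%:R.
    by rewrite powR_mulrn; [field|lra].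
  by apply: ler_powR; clear - omega1 p2; lra.
set T0 := omega0 / S.
have T00 : 0 < T0 by exact: divr_gt0.
have T0S : S * T0 = omega0 by rewrite /T0 mulrC divfK// gt_eqF.
have T0o : T0 * (4 * omega0) <= 1.
  have : 4 * omega0 ^+ 2 * T0 <= omega0 by rewrite -[leRHS]T0S ler_pM2r.
  by rewrite -[leRHS]mul1r expr2 !mulrA -(mulrA 4) (mulrC 4) -!mulrA; nra.
have T0eps : T0 <= eps / 4.
  have : T0 * (4 * eps^-1) <= 1.
    by apply: le_trans T0o; rewrite ler_pM2l// /omega0; lra.
  move=> h; rewrite ler_pdivlMr// -[leRHS]mul1r -ler_pdivrMr//; clear - h; lra.
have T02 : T0 <= 2^-1 by lra.
exists theta, sigma, omega0, T0; split => //.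
- by rewrite sigma0.
- by rewrite /omega0; lra.
- by rewrite T00.
move=> d u subu supu cu uM k x0 t0 x02 t02.
have /andP[t021 t01] := t02.
have ball x : enorm (x - x0) < 2^-1 -> enorm x < 1.
  by move=> xx0; have := enormD (x - x0) x0; rewrite subrK; clear - xx0 x02; lra.
have rk k' : 0 < rho ^+ k' by exact: exprn_gt0.
have sk k' : 0 < sigma ^+ k' by exact: exprn_gt0.
have tk k' : 0 < (1 - theta) ^+ k' by exact: exprn_gt0.
have rho1 k' : rho ^+ k' <= 1 by apply: exprn_ile1; clear - rho0 rhoc c08; lra.
have sigma1 k' : sigma ^+ k' <= 1 by apply: exprn_ile1; clear - sigma0 sigma4; lra.
(* The iteration runs on cylinders of radius [rho^k / 2]. Since [sigma <= rho] and [T0 <= 1/2], they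
   contain those whose radius and height are both [sigma^k * T0]. *)
suff iter : oscillates_within u x0 t0 (rho ^+ k * 2^-1) (sigma ^+ k * T0)
    ((1 - theta) ^+ k * omega0).
  apply: oscillates_within_sub iter => //.
  apply: ler_pM => //; [exact: ltW|exact: ltW|].
  have srho : sigma <= rho.
    by apply: (le_trans sr); rewrite expr2 ler_piMr ?(ltW rho0)//; clear - rhoc c08; lra.
  exact: (lerXn2r k (ltW sigma0) (ltW rho0) srho).
have scalk j : ((1 - theta) ^+ j * omega0 / (rho ^+ j * 2^-1)) `^ p * (sigma ^+ j * T0)
    = (1 - theta) ^+ j * omega0.
  elim: j => [|j IH]; first by rewrite !expr0 !mul1r.
  have -> : (1 - theta) ^+ j.+1 * omega0 / (rho ^+ j.+1 * 2^-1) =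
      ((1 - theta) / rho) * ((1 - theta) ^+ j * omega0 / (rho ^+ j * 2^-1)).
    by rewrite !exprS; field; rewrite !gt_eqF.
  rewrite powRM; last 2 first.
  - by rewrite divr_ge0 ?ltW.
  - by rewrite divr_ge0// ltW// mulr_gt0.
  set X := ((1 - theta) / rho) `^ p in scal *.
  set Y := (_ `^ p) in IH *.
  have -> : X * Y * (sigma ^+ j.+1 * T0) = (X * sigma) * (Y * (sigma ^+ j * T0)).
    by rewrite exprS; ring.
  by rewrite scal IH exprS mulrA.
elim: k => [|k IH].
  rewrite !expr0 !mul1r; exists (- `|M|) => x t /ball x1 tt.
  have : cylinder d 1 0 1 (x, t) by apply: cylinder_center => //; clear - tt t02 T0eps eps1; lra.
  move=> /uM; rewrite ler_norml => /andP[u1 u2].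
  have := ler_norm M; rewrite /omega0 => MM.
  by apply/andP; split; lra.
have Tk : sigma ^+ k * T0 <= T0 by rewrite ler_piMl ?(ltW T00).
have rk2 : rho ^+ k * 2^-1 <= 2^-1 by rewrite ler_piMl.
have c1 : 0 < rho ^+ k * 2^-1 by rewrite mulr_gt0.
have c2 : 0 < (1 - theta) ^+ k * omega0 by rewrite mulr_gt0.
have c3 : 0 < sigma ^+ k * T0 by rewrite mulr_gt0.
have c4 : sigma ^+ k * T0 <= t0 by lra.
have c5 : sigma ^+ k * T0 <= eps * (rho ^+ k * 2^-1) ^+ 2.
  have -> : eps * (rho ^+ k * 2^-1) ^+ 2 = (rho ^+ 2) ^+ k * (eps / 4).
    by rewrite -exprM mulnC exprM; field.
  apply: ler_pM; [exact: ltW|exact: ltW| |exact: T0eps].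
  exact: (lerXn2r k (ltW sigma0) (sqr_ge0 rho) sr).
have c6 : sigma ^+ k * T0 <= eps * ((1 - theta) ^+ k * omega0).
  rewrite (mulrCA eps); apply: ler_pM; [exact: ltW|exact: ltW| |].
    exact: (lerXn2r k (ltW sigma0) (ltW th0) (ltW st)).
  by apply: (le_trans T0eps); rewrite ler_pM2l//; lra.
have ballk x : enorm (x - x0) < rho ^+ k * 2^-1 -> enorm x < 1.
  by move=> xr; apply: ball; exact: lt_le_trans rk2.
have := decay d u x0 t0 _ _ _ subu supu cu c1 c2 c3 c4 t01 (scalk k) c5 c6 ballk IH.
rewrite (mulrA (1 - theta)) -exprS; apply: oscillates_within_sub.
- by rewrite exprS -mulrA ler_pM2r.
- by rewrite exprS -mulrA mulrC ler_pM2l.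
Qed.

End oscillation_iteration.

(** * From geometric decay to a Hölder modulus *)

Section holder_regularity.
Context {R : realType}.
(* [edist] alone denotes the extended distance of the library. *)
Local Notation edist := Defs.edist.

Lemma oscillates_within_closed (d : nat) (u : 'rV[R]_d * R -> R) x0 t0 r T omega :
  {within cylinder d 1 0 1, continuous u} -> 0 < T -> T <= t0 -> t0 <= 1 ->
  (forall x, enorm (x - x0) < r -> enorm x < 1) ->
  oscillates_within u x0 t0 r T omega ->
  exists m, forall x t, enorm (x - x0) < r -> t0 - T <= t <= t0 ->
    m <= u (x, t) <= m + omega.
Proof.
move=> cu T0 Tt t01 ball [m um]; exists m => x t xr /andP[t1 t2].
have [tt0|t0t] := ltP t t0; first by apply: um; rewrite // t1.
have -> : t = t0 by apply/eqP; rewrite eq_le t2.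
have Qxt0 : cylinder d 1 0 1 (x, t0) by apply: cylinder_center; [exact: ball|lra].
have approx e : 0 < e -> m - e <= u (x, t0) <= m + omega + e.
  move=> e0; have [delta delta0 near_t0] := cylinder_continuity cu Qxt0 e0.
  set h := Num.min T (delta / 2).
  have d2 : 0 < delta / 2 by lra.
  have h0 : 0 < h by rewrite lt_min T0.
  have [hT hd] : h <= T /\ h <= delta / 2 by rewrite /h !ge_min !lexx orbT.
  have xx : enorm (x - x) < delta by rewrite subrr enorm0.
  have hh : `|t0 - h - t0| < delta.
    by rewrite addrAC subrr add0r normrN gtr0_norm//; lra.
  have Qh : cylinder d 1 0 1 (x, t0 - h) by apply: cylinder_center; [exact: ball|lra].
  have := near_t0 _ _ xx hh Qh; rewrite ltr_norml => /andP[? ?].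
  have th : t0 - T <= t0 - h < t0 by lra.
  have /andP[? ?] := um _ _ xr th.
  by apply/andP; split; lra.
by apply/andP; split; apply/ler_addgt0Pr => e /approx/andP[? ?]; lra.
Qed.

Lemma exists_expr_le (sigma e : R) : 0 < sigma < 1 -> 0 < e ->
  exists k, sigma ^+ k <= e.
Proof.
move=> /andP[sigma0 sigma1] e0.
have : sigma ^+ n @[n --> \oo] --> 0 by apply: cvg_expr; rewrite gtr0_norm.
move=> /cvgrPdist_lt /(_ _ e0) [N _ /(_ N (leqnn N))].
by rewrite sub0r normrN gtr0_norm ?exprn_gt0// => /ltW; exists N.
Qed.

(** Take the least [k] with [sigma^k * T0 <= e], where [e] is the distance. If [k = 0] the global
    bound applies. Otherwise [e] is below the scale of index [k - 1], and
    [sigma^(k-1) <= e / (sigma * T0)]; this lost step is the factor [sigma] in the constant. *)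
Lemma geometric_modulus_holder (d : nat) (u : 'rV[R]_d * R -> R) (D : set ('rV[R]_d * R))
    (theta sigma alpha omega0 T0 : R) :
  0 < sigma < 1 -> 0 < theta -> 0 < alpha -> 0 <= omega0 -> 0 < T0 ->
  sigma `^ alpha = 1 - theta ->
  (forall z w, D z -> D w -> `|u z - u w| <= omega0) ->
  (forall (k : nat) z w, D z -> D w -> edist z w < sigma ^+ k * T0 ->
    `|u z - u w| <= (1 - theta) ^+ k * omega0) ->
  forall z w, D z -> D w -> 0 < edist z w ->
    `|u z - u w| <= omega0 / (sigma * T0) `^ alpha * edist z w `^ alpha.
Proof.
move=> /andP[sigma0 sigma1] theta0 alpha0 omega00 T00 sa bound modulus z w Dz Dw e0.
set e := edist z w in e0 *.
have sT : 0 < sigma * T0 by exact: mulr_gt0.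
have -> : omega0 / (sigma * T0) `^ alpha * e `^ alpha = omega0 * (e / (sigma * T0)) `^ alpha.
  rewrite (@powRM _ e (sigma * T0)^-1) ?invr_ge0 ?(ltW e0) ?(ltW sT)// -!mulrA; congr (_ * _).
  rewrite mulrC; congr (_ * _).
  by rewrite -(powR_inv1 (ltW sT)) -powRrM mulN1r powRN.
have sk : exists k, sigma ^+ k * T0 <= e.
  have [|k] := @exists_expr_le sigma (e / T0) _ (divr_gt0 e0 T00); first by rewrite sigma0.
  by rewrite ler_pdivlMr//; exists k.
case: (ex_minnP sk) => -[|k] ke kmin.
  move: ke; rewrite expr0 mul1r => T0e.
  apply: (le_trans (bound z w Dz Dw)); apply: ler_peMr => //.
  have h : 1 <= e / (sigma * T0).
    rewrite ler_pdivlMr// mul1r; apply: le_trans T0e; rewrite ler_piMl// ltW//.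
  have := ge0_ler_powR (ltW alpha0) ler01 (le_trans ler01 h) h.
  by rewrite powR1.
have : e < sigma ^+ k * T0.
  by rewrite ltNge; apply/negP => /kmin; rewrite ltnn.
move=> /(modulus k z w Dz Dw) /le_trans; apply.
rewrite mulrC ler_wpM2l// -sa -[X in X <= _]powR_mulrn ?powR_ge0// powRAC.
rewrite powR_mulrn ?(ltW sigma0)//.
have s0 : 0 <= sigma ^+ k by rewrite exprn_ge0// ltW.
have h : sigma ^+ k <= e / (sigma * T0).
  by rewrite ler_pdivlMr// mulrA -exprSr.
exact: (ge0_ler_powR (ltW alpha0) s0 (le_trans s0 h) h).
Qed.

Lemma enorm_le_edist (d : nat) (z w : 'rV[R]_d * R) : enorm (z.1 - w.1) <= edist z w.
Proof.
rewrite /Defs.edist -[leLHS](ger0_norm (enorm_ge0 _)) -sqrtr_sqr ler_sqrt ?addr_ge0 ?sqr_ge0//.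
by rewrite lerDl sqr_ge0.
Qed.

Lemma time_le_edist (d : nat) (z w : 'rV[R]_d * R) : `|z.2 - w.2| <= edist z w.
Proof.
rewrite /Defs.edist -sqrtr_sqr ler_sqrt ?addr_ge0 ?sqr_ge0//.
by rewrite lerDr sqr_ge0.
Qed.

Lemma euclidean_distC (d : nat) (z w : 'rV[R]_d * R) : edist z w = edist w z.
Proof. by rewrite /Defs.edist enormB -[w.2 - z.2]opprB sqrrN. Qed.

Lemma euclidean_dist_gt0 (d : nat) (z w : 'rV[R]_d * R) : z <> w -> 0 < edist z w.
Proof.
move=> zw; rewrite lt_neqAle sqrtr_ge0 andbT; apply/eqP => e0; apply: zw.
have := enorm_le_edist z w; have := time_le_edist z w; rewrite -e0.
rewrite normr_le0 subr_eq0 => /eqP e2 e1.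
have /eqP : z.1 - w.1 = 0 by apply: enorm_eq0; apply/eqP; rewrite eq_le e1 enorm_ge0.
by rewrite subr_eq0 => /eqP; case: z w e2 {e0 e1} => [? ?] [? ?] /= -> ->.
Qed.

(** The cylinders extend backward in time, so the later of the two points is taken as vertex; it
    lies on the top slice, hence the use of the closed version. *)
Lemma oscillation_modulus (d : nat) (u : 'rV[R]_d * R -> R) (rho omega : R) :
  {within cylinder d 1 0 1, continuous u} -> 0 < rho <= 2^-1 ->
  (forall x0 t0, enorm x0 < 2^-1 -> 2^-1 <= t0 <= 1 ->
    oscillates_within u x0 t0 rho rho omega) ->
  forall z w, cylinder d 2^-1 2^-1 1 z -> cylinder d 2^-1 2^-1 1 w ->
    edist z w < rho -> `|u z - u w| <= omega.
Proof.
move=> cu /andP[rho0 rho2] osc.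
suff ordered z w : cylinder d 2^-1 2^-1 1 z -> cylinder d 2^-1 2^-1 1 w ->
    w.2 <= z.2 -> edist z w < rho -> `|u z - u w| <= omega.
  move=> z w Dz Dw zw; have [wz|/ltW zw2] := leP w.2 z.2; first exact: ordered.
  by rewrite distrC; apply: ordered; rewrite // euclidean_distC.
case: z w => [x t] [x' t'] [/= xD]; rewrite in_itv/= => tD [/= x'D].
rewrite in_itv/= => t'D t't e.
have ball y : enorm (y - x) < rho -> enorm y < 1.
  move: xD; rewrite /eball/= => xD yx.
  by have := enormD (y - x) x; rewrite subrK; lra.
have rt : rho <= t by lra.
have /andP[_ t1] := tD.
have [m um] := oscillates_within_closed cu rho0 rt t1 ball (osc x t xD tD).
have tt' : t - rho <= t' <= t.
  have := le_lt_trans (time_le_edist _ _) e; rewrite /= ltr_norml => /andP[? ?].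
  by rewrite t't andbT; lra.
have xx' : enorm (x' - x) < rho.
  by rewrite enormB; exact: le_lt_trans (enorm_le_edist _ _) e.
have xx : enorm (x - x) < rho by rewrite subrr enorm0.
have tt : t - rho <= t <= t by lra.
have /andP[? ?] := um _ _ xx' tt'.
have /andP[? ?] := um _ _ xx tt.
by rewrite ler_norml; apply/andP; split; lra.
Qed.

End holder_regularity.

(** * The uniform Hölder estimate *)

Theorem theorem1p2 (R : realType) (d : nat) (p A M : R) :
  (1 <= d)%N -> 2 < p -> 0 < A ->
  exists alpha C : R,
    [/\ 0 < alpha, alpha < 1 &
    forall (H : hamiltonian R d) (u : 'rV[R]_d * R -> R),
      growth_condition p A (cylinder d 1 0 1) H ->
      viscosity_solution (cylinder d 1 0 1) H u ->
      (sup_norm (cylinder d 1 0 1) u <= M%:E)%E ->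
      (holder_norm alpha (cylinder d 2^-1 2^-1 1) u <= C%:E)%E].
Proof.
move=> d0 p2 A0.
have [theta [sigma [omega0 [T0 [theta0 /andP[sigma0 sigmath] Momega /andP[T00 T02] osc]]]]] :=
  @oscillation_geometric R p A M p2 A0.
have th0 : 0 < 1 - theta by lra.
have sigma1 : sigma < 1 by lra.
have lns : ln sigma < 0 by rewrite ln_lt0// sigma0.
have lnth : ln (1 - theta) < 0 by apply: ln_lt0; lra.
(* [sigma^alpha = 1 - theta] turns the geometric decay into a Hoelder modulus *)
set alpha := ln (1 - theta) / ln sigma.
have alpha0 : 0 < alpha by rewrite /alpha -mulrNN -invrN divr_gt0 ?oppr_gt0.
(* Both logarithms are negative, so this is the inequality [sigma < 1 - theta]. *)
have alpha1 : alpha < 1.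
  rewrite /alpha -mulrNN -invrN ltr_pdivrMr ?oppr_gt0// mul1r ltrN2.
  by rewrite ltr_ln ?posrE.
have sa : sigma `^ alpha = 1 - theta.
  by rewrite /powR gt_eqF// /alpha divfK ?lt_eqF// lnK ?posrE.
have omega00 : 0 <= omega0 by apply: le_trans Momega; exact: mulr_ge0.
exists alpha, (M + omega0 / (sigma * T0) `^ alpha).
split=> // H u growth [subu supu] supM.
set Q := cylinder d 1 0 1 in growth subu supu supM *.
set D := cylinder d 2^-1 2^-1 1.
have cu : {within Q, continuous u} by case: subu.
have uM z : Q z -> `|u z| <= M.
  move=> Qz; rewrite -lee_fin; apply: le_trans supM.
  by apply: ereal_sup_ubound; exists z.
have DQ : D `<=` Q.
  move=> z [/= z1]; rewrite in_itv/= => z2; split=> /=.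
    by move: z1; rewrite /eball/=; lra.
  by rewrite in_itv/=; lra.
have bound z w : D z -> D w -> `|u z - u w| <= omega0.
  move=> /DQ/uM zM /DQ/uM wM; apply: le_trans Momega.
  have := ler_normB (u z) (u w); have := ler_norm M; lra.
have modulus (k : nat) z w : D z -> D w -> Defs.edist z w < sigma ^+ k * T0 ->
    `|u z - u w| <= (1 - theta) ^+ k * omega0.
  apply: oscillation_modulus => //.
    have sk : 0 < sigma ^+ k by exact: exprn_gt0.
    have sk1 : sigma ^+ k <= 1 by apply: exprn_ile1; lra.
    by rewrite mulr_gt0//=; apply: le_trans T02; rewrite ler_piMl// ltW.
  move=> x0 t0; apply: (osc d u) => //.
    exact: viscosity_subsolution_quadratic growth subu.
  exact: viscosity_supersolution_quadratic growth supu.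
rewrite /holder_norm EFinD; apply: leeD.
  apply: ge_ereal_sup => _ [z Dz <-]; rewrite lee_fin.
  exact/uM/DQ.
apply: ge_ereal_sup => _ [z [w [Dz Dw zw ->]]]; rewrite lee_fin.
have e0 := euclidean_dist_gt0 zw.
rewrite ler_pdivrMr ?powR_gt0//.
apply: (geometric_modulus_holder (D := D) (theta := theta)) => //.
by rewrite sigma0.
Qed.
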